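(* Let $\mu>-1$ and $\rho>0$, and let $\{P_n(\cdot;\mu,\rho)\}_{n\ge 0}$ be the threefold symmetric polynomial sequence defined by $P_0(x)=1$, $P_1(x)=x$, $P_2(x)=x^2$ and $P_{n+1}(x)=xP_n(x)-\gamma_{n-1}P_{n-2}(x)$ for $n\ge 2$, where $$\gamma_{2n}=\frac{2n(2n+1)(n+\mu)}{(3n+\mu-1)(3n+\mu+2)(3n+\rho)}\ (n\ge 1),\qquad \gamma_{2n+1}=\frac{2(n+1)(2n+1)(n+\rho)}{(3n+\mu+2)(3n+\rho)(3n+\rho+3)}\ (n\ge 0).$$ Then $\{P_n(\cdot;\mu,\rho)\}_{n\ge0}$ is $2$-orthogonal with respect to the pair of linear functionals $(u_0,u_1)$ given, for every polynomial $f$ and $k=0,1$, by $$\langle u_k,f\rangle=\frac13\left(\int_0^{1}f(x)\,\mathcal U_k(x)\,dx+\omega^{2k-1}\int_0^{\omega}f(x)\,\mathcal U_k(\omega^2x)\,dx+\omega^{1-2k}\int_0^{\omega^2}f(x)\,\mathcal U_k(\omega x)\,dx\right),$$ where $\omega=e^{2\pi i/3}$ and, for $0<x<1$, $$\mathcal U_0(x)=\frac{3\,\Gamma(\frac{\mu+2}{3})\Gamma(\frac{\rho}{3}+1)}{\Gamma(\frac13)\Gamma(\frac23)\Gamma(\frac{\mu+\rho+2}{3})}\,(1-x^3)^{\frac{\mu+\rho-1}{3}}\;{}_2F_1\!\left(\tfrac{\mu}{3},\tfrac{\rho+1}{3};\tfrac{\mu+\rho+2}{3};1-x^3\right),$$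 $$\mathcal U_1(x)=\frac{3\,\Gamma(\frac{\mu+5}{3})\Gamma(\frac{\rho}{3}+1)}{\Gamma(\frac23)\Gamma(\frac43)\Gamma(\frac{\mu+\rho+2}{3})}\,x^2(1-x^3)^{\frac{\mu+\rho-1}{3}}\;{}_2F_1\!\left(\tfrac{\mu}{3}+1,\tfrac{\rho+1}{3};\tfrac{\mu+\rho+2}{3};1-x^3\right).$$
   Context: ${}_2F_1(a,b;c;z)$ is the Gauss hypergeometric function. The integrals $\int_0^{\omega^j}$ are along the straight segments from $0$ to $\omega^j$, on which the arguments $\omega^2x$, $\omega x$ of $\mathcal U_k$ lie in $[0,1]$. A sequence of monic polynomials $\{P_n\}_{n\ge0}$ ($\deg P_n=n$) is $2$-orthogonal with respect to $(u_0,u_1)$ if for all $m,n\ge 0$: $\langle u_0,x^mP_n\rangle=0$ if $n\ge 2m+1$ and $\langle u_0,x^mP_{2m}\rangle\neq 0$; $\langle u_1,x^mP_n\rangle=0$ if $n\ge 2m+2$ and $\langle u_1,x^mP_{2m+1}\rangle\ne 0$. Threefold symmetric means $P_n(\omega x)=\omega^nP_n(x)$ for all $n$. *)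

(* Defs.v *)
From HB Require Import structures.
From mathcomp Require Import all_boot all_order all_algebra.
From mathcomp Require Import all_classical all_reals all_analysis.
From mathcomp Require Export complex.

Set Implicit Arguments.
Unset Strict Implicit.
Unset Printing Implicit Defensive.

Import Order.TTheory GRing.Theory Num.Theory.
Import numFieldNormedType.Exports.

Local Open Scope classical_set_scope.
Local Open Scope complex_scope.
Local Open Scope ring_scope.

Section SpecialFunctions.
Context {R : realType}.
Implicit Types a b c s z : R.

(* Euler's integral, which represents the Gamma function for s > 0. *)
Definition Gamma s : R :=
  \int[lebesgue_measure]_(t in `]0, +oo[) (t `^ (s - 1) * expR (- t)).

Definition pochhammer a (n : nat) : R := \prod_(i < n) (a + i%:R).

(* The Gauss series; it converges for `|z| < 1 when c is not in {0, -1, ...}. *)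
Definition hyp2F1 a b c z : R :=
  limn (series (fun n : nat =>
    pochhammer a n * pochhammer b n / (pochhammer c n * n`!%:R) * z ^+ n)).

End SpecialFunctions.

Section ComplexIntegration.
Context {R : realType}.

(* e^(2 i pi / 3) *)
Definition omega : R[i] := cos (2 * pi / 3) +i* sin (2 * pi / 3).

(* The parametrization t |-> t z of the segment from 0 to z, 0 < t < 1, is used;
   the (possibly singular) end points are left out. *)
Definition segment_integrand (z : R[i]) (g : R[i] -> R[i]) (t : R) : R[i] :=
  g (t%:C * z) * z.

Definition segment_integrable (z : R[i]) (g : R[i] -> R[i]) : Prop :=
  let h := segment_integrand z g in
  lebesgue_measure.-integrable `]0, 1[ (fun t : R => (complex.Re (h t))%:E) /\
  lebesgue_measure.-integrable `]0, 1[ (fun t : R => (complex.Im (h t))%:E).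

Definition segment_integral (z : R[i]) (g : R[i] -> R[i]) : R[i] :=
  let h := segment_integrand z g in
  (\int[lebesgue_measure]_(t in `]0, 1[) complex.Re (h t)) +i*
  (\int[lebesgue_measure]_(t in `]0, 1[) complex.Im (h t)).

(* The integrand x |-> f(x) U(omega^(-j) x) on the segment from 0 to omega^j.
   There omega^(-j) x is a real number of [0, 1], so that Re only turns it into
   an element of R. *)
Definition ray_integrand (U : R -> R) (f : {poly R[i]}) (j : nat) (x : R[i]) :
    R[i] :=
  f.[x] * (U (complex.Re (omega ^- j * x)))%:C.

Definition ray_functional (k : nat) (U : R -> R) (f : {poly R[i]}) : R[i] :=
  3^-1 *
  (segment_integral 1 (ray_integrand U f 0)
   + omega ^ (2 * k%:Z - 1) * segment_integral omega (ray_integrand U f 1)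
   + omega ^ (1 - 2 * k%:Z) *
       segment_integral (omega ^+ 2) (ray_integrand U f 2)).

Definition ray_integrable (U : R -> R) (f : {poly R[i]}) : Prop :=
  forall j : nat, (j < 3)%N ->
    segment_integrable (omega ^+ j) (ray_integrand U f j).

End ComplexIntegration.

Section Orthogonality.
Context {R : realType}.
Implicit Types (P : nat -> {poly R[i]}) (u : {poly R[i]} -> R[i]).

Definition monic_sequence P : Prop :=
  forall n, P n \is monic /\ size (P n) = n.+1.

Definition threefold_symmetric P : Prop :=
  forall (n : nat) (x : R[i]), (P n).[omega * x] = omega ^+ n * (P n).[x].

Definition two_orthogonal u0 u1 P : Prop :=
  [/\ monic_sequence P,
      scalar u0 /\ scalar u1,
      forall m : nat,
        (forall n : nat, (2 * m + 1 <= n)%N -> u0 ('X^m * P n) = 0) /\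
        u0 ('X^m * P (2 * m)%N) != 0
    & forall m : nat,
        (forall n : nat, (2 * m + 2 <= n)%N -> u1 ('X^m * P n) = 0) /\
        u1 ('X^m * P (2 * m + 1)%N) != 0].

End Orthogonality.

Section Weights.
Context {R : realType}.
Variables mu rho : R.

(* Only the values at n >= 1 are meaningful. *)
Definition gamma_coef (n : nat) : R :=
  let m : R := (n./2)%:R in
  if odd n then
    2 * (m + 1) * (2 * m + 1) * (m + rho) /
    ((3 * m + mu + 2) * (3 * m + rho) * (3 * m + rho + 3))
  else
    2 * m * (2 * m + 1) * (m + mu) /
    ((3 * m + mu - 1) * (3 * m + mu + 2) * (3 * m + rho)).

Definition calU0 (x : R) : R :=
  3 * Gamma ((mu + 2) / 3) * Gamma (rho / 3 + 1) /
    (Gamma (1 / 3) * Gamma (2 / 3) * Gamma ((mu + rho + 2) / 3)) *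
  (1 - x ^+ 3) `^ ((mu + rho - 1) / 3) *
  hyp2F1 (mu / 3) ((rho + 1) / 3) ((mu + rho + 2) / 3) (1 - x ^+ 3).

Definition calU1 (x : R) : R :=
  3 * Gamma ((mu + 5) / 3) * Gamma (rho / 3 + 1) /
    (Gamma (2 / 3) * Gamma (4 / 3) * Gamma ((mu + rho + 2) / 3)) *
  x ^+ 2 * (1 - x ^+ 3) `^ ((mu + rho - 1) / 3) *
  hyp2F1 (mu / 3 + 1) ((rho + 1) / 3) ((mu + rho + 2) / 3) (1 - x ^+ 3).

End Weights.

(* Main.v *)
Require Import Defs.
From mathcomp Require Import all_boot all_order all_algebra.
From mathcomp Require Import all_classical all_reals all_analysis.
From mathcomp Require Import measurable_realfun ring lra zify.

Set Implicit Arguments.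
Unset Strict Implicit.
Unset Printing Implicit Defensive.

Import Order.TTheory GRing.Theory Num.Theory.
Import numFieldNormedType.Exports.

Local Open Scope classical_set_scope.
Local Open Scope complex_scope.
Local Open Scope ring_scope.

(** The recurrence inverts in closed form: X^n = sum_j e(n - 3j, j) P_(n - 3j)
    with e(k, j) = (k + 3j)! / (k! j! 27^j (alpha_k)_j (beta_k)_j), where
    alpha_k = (mu + 2)/3 + ceil(k/2) and beta_k = rho/3 + 1 + floor(k/2). Hence
    a functional u that vanishes on X^n for n <> k mod 3 and satisfies
    u(X^(k + 3j)) = e(k, j) u(X^k) kills every P_n with n <> k. Given two such
    functionals, for k = 0 and 1, X P_n = P_(n+1) + gamma_(n-1) P_(n-2)
    propagates the orthogonality conditions from m to m + 1.

    Summing over the three rays leaves only the moments int_0^1 x^(k + 3j) U_k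
    of order k mod 3. Termwise integration of the hypergeometric series shows
    that int_0^1 x^p (1 - x^3)^(c-1) 2F1(a, b; c; 1 - x^3) dx is a beta integral
    times S(C) = 2F1(a, b; C; 1), C = (p + 1)/3 + c. The relation
    C (C - a - b) S(C) = (C - a)(C - b) S(C + 1) gives the ratio of consecutive
    moments, which is that of the e(k, j). The exact normalization plays no
    role: positivity of S and of the Gamma factors yields u_k(X^k) <> 0. *)

(** * Connection coefficients *)

Lemma pochhammerS (R : realType) (a : R) n :
  pochhammer a n.+1 = pochhammer a n * (a + n%:R).
Proof. by rewrite /pochhammer big_ord_recr. Qed.

Lemma pochhammerSl (R : realType) (a : R) n :
  pochhammer a n.+1 = a * pochhammer (a + 1) n.
Proof.
rewrite /pochhammer big_ord_recl addr0; congr (_ * _).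
by apply: eq_bigr => i _; rewrite lift0 -natr1 addrAC addrA.
Qed.

Lemma pochhammer_gt0 (R : realType) (a : R) n : 0 < a -> 0 < pochhammer a n.
Proof. by move=> a0; apply: prodr_gt0 => i _; rewrite ltr_wpDr. Qed.

Section connection.
Context {R : realType}.
Variables mu rho : R.
Hypotheses (hmu : -1 < mu) (hrho : 0 < rho).

Definition connA (k : nat) : R := (mu + 2) / 3 + (uphalf k)%:R.
Definition connB (k : nat) : R := rho / 3 + 1 + (k./2)%:R.

(* The coefficient of [P k] in the expansion of [X^(k + 3 j)]. *)
Definition conn (k j : nat) : R :=
  (k + 3 * j)`!%:R /
  (k`!%:R * j`!%:R * 27 ^+ j * pochhammer (connA k) j * pochhammer (connB k) j).

Lemma connA_gt0 k : 0 < connA k.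
Proof. by rewrite ltr_wpDr//; have := hmu; lra. Qed.

Lemma connB_gt0 k : 0 < connB k.
Proof. by rewrite ltr_wpDr//; have := hrho; lra. Qed.

Lemma connk0 k : conn k 0 = 1.
Proof.
by rewrite /conn /pochhammer !big_ord0 muln0 addn0 fact0 expr0 !mulr1 divff//
  pnatr_eq0 -lt0n fact_gt0.
Qed.

Lemma factSr n : (n.+1)`!%:R = (n%:R + 1) * n`!%:R :> R.
Proof. by rewrite factS natrM -natr1. Qed.

Lemma factr_neq0 n : n`!%:R != 0 :> R.
Proof. by rewrite pnatr_eq0 -lt0n fact_gt0. Qed.

(** Only this ratio of consecutive coefficients is compared with the moments; the closed form then
    follows by induction on [j]. *)
Lemma connS k j : conn k j.+1 = conn k j *
  ((k%:R + 3 * j%:R + 1) * (k%:R + 3 * j%:R + 2) * (k%:R + 3 * j%:R + 3) /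
   (27 * (j%:R + 1) * (connA k + j%:R) * (connB k + j%:R))).
Proof.
have A0 := connA_gt0 k; have B0 := connB_gt0 k.
rewrite /conn (_ : k + 3 * j.+1 = (k + 3 * j).+3)%N; last by lia.
rewrite !factSr !pochhammerS exprS -(natr1 (k + 3 * j).+1) -(natr1 (k + 3 * j)).
rewrite natrD natrM.
have pA : pochhammer (connA k) j != 0 by rewrite gt_eqF// pochhammer_gt0.
have pB : pochhammer (connB k) j != 0 by rewrite gt_eqF// pochhammer_gt0.
have fk := factr_neq0 k; have fj := factr_neq0 j.
have z0 : (27 : R) ^+ j != 0 by rewrite expf_neq0//; lra.
have j0 := ler0n R j.
field; rewrite pA pB fk fj z0 /= andbT.
by do ?(apply/andP; split); apply/eqP; lra.
Qed.

(** Brings [pochhammer a j.+1] over the factor shifted by two, so that the three coefficients in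
    [conn_shiftS] share the same Pochhammer symbols. *)
Lemma pochhammerSl2 (a : R) j : 0 < a ->
  pochhammer a j.+1 = a * (a + 1) * pochhammer (a + 1 + 1) j / (a + 1 + j%:R).
Proof.
move=> a0; have j0 : 0 <= j%:R :> R by [].
have nz : a + 1 + j%:R != 0 by apply/eqP; lra.
apply: (mulIf nz); rewrite divfK// -mulrA -!pochhammerSl [in RHS]pochhammerS.
by rewrite -natr1 [j%:R + 1]addrC addrA.
Qed.

(** Compares the coefficients of [P k.+1] in X * X^(k + 3(j + 1)): it receives the leading part of X
    [P k] and the [gamma_coef] part of X [P k.+3]. *)
Lemma conn_shiftS (k j : nat) :
  conn k.+1 j.+1 = conn k j.+1 + gamma_coef mu rho k.+2 * conn k.+3 j.
Proof.
have fk := factr_neq0 k; have fj := factr_neq0 j.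
have fkj := factr_neq0 (k.+3 + 3 * j).
have e0 : (k + 3 * j.+1 = k.+3 + 3 * j)%N by lia.
have e1 : (k.+1 + 3 * j.+1 = (k.+3 + 3 * j).+1)%N by lia.
have j0 : 0 <= j%:R :> R by [].
have z0 : (27 : R) ^+ j != 0 by rewrite expf_neq0//; lra.
have hm := hmu; have hr := hrho.
rewrite /conn e0 e1 /gamma_coef.
rewrite (factSr (k.+3 + _)) !(factSr k.+2, factSr k.+1, factSr k, factSr j).
have e3 : (k.+3 + 3 * j)%:R = k%:R + 3 + 3 * j%:R :> R.
  by rewrite natrD -!natr1 natrM; ring.
rewrite e3 exprS; move: fkj fk; set Q := (k.+3 + _)`!%:R; set K := k`!%:R.
move: Q K => Q K Q0 K0 {e0 e1 e3}.
rewrite -(natr1 k.+1) -(natr1 k).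
(* The parity of [k] decides the branch of [gamma_coef] and which of [connA], [connB] moves when [k]
   grows by one. *)
have [m km] : exists m : nat, k = m.*2 \/ k = m.*2.+1.
  exists (k./2); move: (odd_double_half k).
  by case: (odd k) => /= H; [right|left]; rewrite -[LHS]H.
case: km => kE; subst k.
all: rewrite /connA /connB /= !uphalf_half /= !odd_double /=.
all: have m0 : 0 <= m%:R :> R by [].
all: rewrite ?add0n ?doubleK -?(natr1 m.+2) -?(natr1 m.+1) -?(natr1 m)
  -?(natr1 m.*2.+2) -?(natr1 m.*2.+1) -?(natr1 m.*2) -?muln2 ?natrM.
(* Even [k]: passing to [k.+1] and [k.+3] raises [connA] by 1 and 2, and [connB] by 0 and 1. For odd
   [k] the two exchange roles. *)
- have a0 : 0 < (mu + 2) / 3 + m%:R by lra.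
  have b0 : 0 < rho / 3 + 1 + m%:R by lra.
  rewrite (pochhammerSl2 _ a0) (_ : _ + (m%:R + 1) = (mu + 2) / 3 + m%:R + 1);
    last by ring.
  rewrite (pochhammerSl (_ + m%:R + 1)) (pochhammerSl (_ + m%:R)).
  rewrite (_ : (mu + 2) / 3 + (m%:R + 1 + 1) = (mu + 2) / 3 + m%:R + 1 + 1);
    last by ring.
  rewrite (_ : rho / 3 + 1 + (m%:R + 1) = rho / 3 + 1 + m%:R + 1); last by ring.
  set X := pochhammer _ j; set Y := pochhammer (_ + m%:R + 1) j.
  have X0 : X != 0 by rewrite gt_eqF// pochhammer_gt0//; lra.
  have Y0 : Y != 0 by rewrite gt_eqF// pochhammer_gt0//; lra.
  field.
  rewrite X0 Y0 K0 fj z0 /=; do ! (apply/andP; split); apply/eqP; lra.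
- have a0 : 0 < (mu + 2) / 3 + m%:R by lra.
  have b0 : 0 < rho / 3 + 1 + m%:R by lra.
  rewrite (pochhammerSl2 _ b0).
  rewrite (_ : rho / 3 + 1 + (m%:R + 1) = rho / 3 + 1 + m%:R + 1); last by ring.
  rewrite (_ : (mu + 2) / 3 + (m%:R + 1 + 1) = (mu + 2) / 3 + (m%:R + 1) + 1);
    last by ring.
  rewrite (_ : rho / 3 + 1 + (m%:R + 1 + 1) = rho / 3 + 1 + m%:R + 1 + 1);
    last by ring.
  rewrite (pochhammerSl (_ + m%:R + 1)) (pochhammerSl (_ + (m%:R + 1))).
  set X := pochhammer (_ + (m%:R + 1) + 1) j; set Y := pochhammer _ j.
  have X0 : X != 0 by rewrite gt_eqF// pochhammer_gt0//; lra.
  have Y0 : Y != 0 by rewrite gt_eqF// pochhammer_gt0//; lra.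
  field.
  rewrite X0 Y0 K0 fj z0 /=; do ! (apply/andP; split); apply/eqP; lra.
Qed.

(** Boundary case of the shift: [P 0] arises in X * X^(2 + 3j) only from the [gamma_coef] part of X
    [P 2]. *)
Lemma conn0S (j : nat) :
  conn 0 j.+1 = gamma_coef mu rho 1 * conn 2 j.
Proof.
have fj := factr_neq0 j.
have fkj := factr_neq0 (2 + 3 * j).
have e0 : (0 + 3 * j.+1 = (2 + 3 * j).+1)%N by lia.
have j0 : 0 <= j%:R :> R by [].
have z0 : (27 : R) ^+ j != 0 by rewrite expf_neq0//; lra.
have hm := hmu; have hr := hrho.
rewrite /conn e0 (factSr (2 + _)) (factSr j) /gamma_coef /connA /connB.
rewrite [odd _]/= [uphalf 0]/= [0./2]/= [uphalf 2]/= [2./2]/= [1./2]/= exprS.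
rewrite !addr0 natrD natrM.
set Q := (_ + _)`!%:R in fkj *.
rewrite (pochhammerSl ((mu + 2) / 3)) (pochhammerSl (rho / 3 + 1)).
set X := pochhammer ((mu + 2) / 3 + 1) j; set Y := pochhammer _ j.
have X0 : X != 0 by rewrite gt_eqF// pochhammer_gt0//; lra.
have Y0 : Y != 0 by rewrite gt_eqF// pochhammer_gt0//; lra.
rewrite (_ : 2`! = 2%N)// (_ : 0`! = 1%N)//.
field.
rewrite X0 Y0 fj z0 /=; do ! (apply/andP; split); apply/eqP; lra.
Qed.

End connection.

(** * Orthogonality from dual functionals *)

Section scalar_functional.
Context {F : fieldType} {V : lmodType F}.
Variable u : V -> F.
Hypothesis u_scalar : scalar u.

Lemma scalar0 : u 0 = 0.
Proof.
have := u_scalar 1 0 0; rewrite scaler0 addr0 mul1r -{1}[u 0]addr0.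
by move/addrI.
Qed.

Lemma scalarD x y : u (x + y) = u x + u y.
Proof. by have := u_scalar 1 x y; rewrite scale1r mul1r. Qed.

Lemma scalarZ a x : u (a *: x) = a * u x.
Proof. by have := u_scalar a x 0; rewrite !addr0 scalar0 addr0. Qed.

Lemma scalar_sum (I : Type) (r : seq I) (Q : pred I) (f : I -> V) :
  u (\sum_(i <- r | Q i) f i) = \sum_(i <- r | Q i) u (f i).
Proof. by apply: (big_morph u); [exact: scalarD | exact: scalar0]. Qed.

End scalar_functional.

Section recurrence.
Context {R : realType}.
Variables mu rho : R.
Hypotheses (hmu : -1 < mu) (hrho : 0 < rho).
Variable P : nat -> {poly R[i]}.
Hypotheses (P0 : P 0%N = 1) (P1 : P 1%N = 'X) (P2 : P 2%N = 'X^2).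
Hypothesis Prec : forall n : nat, (2 <= n)%N ->
  P n.+1 = 'X * P n - (gamma_coef mu rho n.-1)%:C *: P n.-2.

Lemma gamma_coef_gt0 n : 0 < gamma_coef mu rho n.+1.
Proof.
have hm := hmu; have hr := hrho; rewrite /gamma_coef.
have [m [->|->]] : exists m, n.+1 = m.*2.+1 \/ n.+1 = m.+1.*2.
  exists (n./2); rewrite -{1 3}(odd_double_half n).
  by case: (odd n) => /=; [right; rewrite doubleS|left].
all: rewrite /= ?odd_double /= ?uphalf_double ?doubleK.
all: rewrite -?(natr1 m); have m0 : 0 <= m%:R :> R by [].
all: by rewrite divr_gt0//; do ?[apply: mulr_gt0]; lra.
Qed.

Lemma mulX_P n :
  'X * P n.+2 = P n.+3 + (gamma_coef mu rho n.+1)%:C *: P n.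
Proof. by rewrite (Prec (n := n.+2))// subrK. Qed.

Lemma mulX_P0 : 'X * P 0 = P 1%N. Proof. by rewrite P0 P1 mulr1. Qed.

Lemma mulX_P1 : 'X * P 1%N = P 2%N. Proof. by rewrite P1 P2 expr2. Qed.

Lemma P_small k : (k < 3)%N -> P k = 'X^k.
Proof. by case: k => [|[|[]]]//; rewrite ?P0 ?P1 ?expr0 ?expr1. Qed.

(** The guard makes the terms with 3j > n vanish; the truncated difference would otherwise produce
    spurious multiples of [P 0]. *)
Let T n j := if (3 * j <= n)%N
  then (conn mu rho (n - 3 * j) j)%:C *: P (n - 3 * j) else 0.

(** Induction on [n]. Multiplying the [j]-th term by X splits it into [A n j], carried by the next
    polynomial, and [B n j], carried by the one two below; [A n j.+1] and [B n j] sit on the same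
    polynomial and add up to the new term [j.+1]. *)
Lemma expansion_monomial n : 'X^n = \sum_(j < n.+1) T n j.
Proof.
pose A m j := if (3 * j <= m)%N
  then (conn mu rho (m - 3 * j) j)%:C *: P (m - 3 * j).+1 else 0.
pose B m j := if (3 * j + 2 <= m)%N
  then ((conn mu rho (m - 3 * j) j) * gamma_coef mu rho (m - 3 * j).-1)%:C
         *: P (m - 3 * j).-2 else 0.
have XT m j : 'X * T m j = A m j + B m j.
  rewrite /T /A /B; case: (leqP (3 * j) m) => jm; last first.
    by rewrite ifN ?mulr0 ?addr0//; lia.
  rewrite -scalerAr; have -> : (3 * j + 2 <= m)%N = (2 <= m - 3 * j)%N by lia.
  case: (m - 3 * j)%N => [|[|k]] /=; rewrite ?mulX_P0 ?mulX_P1 ?addr0//.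
  by rewrite mulX_P scalerDr [(_ * gamma_coef _ _ _)%:C]rmorphM scalerA.
have TS0 m : T m.+1 0 = A m 0%N.
  by rewrite /T /A muln0 /= !subn0 !connk0.
have TS m j : T m.+1 j.+1 = A m j.+1 + B m j.
  rewrite /T /A /B; have -> : (3 * j.+1 <= m.+1)%N = (3 * j + 2 <= m)%N by lia.
  case: (leqP (3 * j + 2) m) => jm; last by rewrite ifN ?addr0//; lia.
  have -> : (3 * j.+1 <= m)%N = (3 * j + 2 < m)%N by lia.
  have {jm} [k mk] : exists k, m = (3 * j + 2 + k)%N by exists (m - (3 * j +
    2))%N; lia.
  have -> : (m - 3 * j = k.+2)%N by lia.
  have -> : (m.+1 - 3 * j.+1 = k)%N by lia.
  case: ltnP => km.
    case: k mk => [|k] mk; first by lia.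
    have -> : (m - 3 * j.+1 = k)%N by lia.
    by rewrite -scalerDl -rmorphD /= conn_shiftS// [gamma_coef _ _ _ * _]mulrC.
  have {km mk} -> : k = 0%N by lia.
  by rewrite add0r /= conn0S// mulrC.
elim: n => [|n IH].
  by rewrite big_ord_recl big_ord0 addr0 /T muln0 /= subn0 connk0 P0 scale1r
    expr0.
rewrite exprS IH [in RHS]big_ord_recl TS0 mulr_sumr.
under eq_bigr do rewrite XT.
rewrite big_split /=.
under [X in _ = _ + X]eq_bigr do rewrite TS.
rewrite [in RHS]big_split /= addrA; congr (_ + _).
rewrite big_ord_recl /= -(big_mkord xpredT (fun j => A n j.+1)).
rewrite -(big_mkord xpredT (fun j => A n j.+1)) [in RHS]big_nat_recr//=.
(* The extra top term [A n n.+1] is zero because 3(n + 1) > n. *)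
by rewrite [X in _ = _ + (_ + X)](_ : _ = 0) ?addr0// /A ifN//; lia.
Qed.

Section dual_functional.
Variables (u : {poly R[i]} -> R[i]) (k : nat).
Hypotheses (u_scalar : scalar u) (k3 : (k < 3)%N).
Hypothesis u0 : forall n, (n %% 3)%N != k -> u 'X^n = 0.
Hypothesis uk : forall j,
  u 'X^(k + 3 * j) = (conn mu rho k j)%:C * u 'X^k.

(** Strong induction: apply [u] to the expansion of X^n. All terms below [P n] are already killed
    except possibly the one carried by [P k], which is present exactly when n = k mod 3. *)
Lemma dual_functional n : n != k -> u (P n) = 0.
Proof.
elim/ltn_ind: n => n IH nk.
have := congr1 u (expansion_monomial n); rewrite (scalar_sum u_scalar).
rewrite big_ord_recl {1}/T muln0 /= subn0 connk0 scale1r.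
have [nk3|nk3] := eqVneq (n %% 3)%N k; last first.
  rewrite (u0 nk3) big1 ?addr0// => j _.
  rewrite /T /= /bump /= add1n; case: ifPn => jn; last by rewrite (scalar0
    u_scalar).
  rewrite (scalarZ u_scalar) IH ?mulr0//; first by lia.
  by apply: contraNneq nk3 => E; apply/eqP; lia.
(* The term on [P k] has index [J.+1], that is [J] once the head of the sum is split off. Its value
   [conn mu rho k J.+1] times u(X^k) equals u(X^n), which leaves u([P n]) = 0. *)
have [J nJ] : exists J, n = (k + 3 * J.+1)%N by exists (n %/ 3).-1; lia.
have Jn : (J < n)%N by lia.
rewrite (bigD1 (Ordinal Jn))//= big1 ?addr0; last first.
  move=> j jJ; rewrite /T /= /bump /= add1n; case: ifPn => jn; last by rewrite
    (scalar0 u_scalar).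
  rewrite (scalarZ u_scalar) IH ?mulr0//; first by lia.
  apply: contraNneq jJ => jk; apply/eqP/val_inj => /=; lia.
rewrite /T /= /bump /= add1n ifT; last by lia.
rewrite (_ : n - 3 * J.+1 = k)%N; last by lia.
rewrite (scalarZ u_scalar) {1}nJ uk (P_small k3) -{1}[LHS]add0r => /addIr.
by move=> <-.
Qed.

End dual_functional.

(** Absorbing one factor X lowers the index of [P] by at most two, so the vanishing threshold grows
    by two with each [m]. At the threshold only the [gamma_coef] term survives, and its coefficient
    is nonzero. *)
Lemma two_orthogonal_of_dual (u0 u1 : {poly R[i]} -> R[i]) :
  scalar u0 -> scalar u1 ->
  (forall n, n != 0%N -> u0 (P n) = 0) -> u0 (P 0%N) != 0 ->
  (forall n, n != 1%N -> u1 (P n) = 0) -> u1 (P 1%N) != 0 ->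
  (forall m : nat,
     (forall n : nat, (2 * m + 1 <= n)%N -> u0 ('X^m * P n) = 0) /\
     u0 ('X^m * P (2 * m)%N) != 0) /\
  (forall m : nat,
     (forall n : nat, (2 * m + 2 <= n)%N -> u1 ('X^m * P n) = 0) /\
     u1 ('X^m * P (2 * m + 1)%N) != 0).
Proof.
move=> lu0 lu1 u0P u00 u1P u11.
have g0 n : (gamma_coef mu rho n.+1)%:C != 0 :> R[i].
  by rewrite fmorph_eq0 gt_eqF// gamma_coef_gt0.
split; elim => [|m [IH IHm]].
- rewrite expr0 mul1r; split => // n n1; rewrite mul1r u0P//; lia.
- have uS (n : nat) : u0 ('X^(m.+1) * P n.+2) = u0 ('X^m * P n.+3) +
      (gamma_coef mu rho n.+1)%:C * u0 ('X^m * P n).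
    by rewrite exprSr -mulrA mulX_P mulrDr (scalarD lu0) -scalerAr (scalarZ
      lu0).
  split => [[|[|n]] nm|]; try lia.
    by rewrite uS !IH ?mulr0 ?addr0//; lia.
  rewrite (_ : 2 * m.+1 = (2 * m).+2)%N; last by lia.
  by rewrite uS IH ?add0r ?mulf_neq0//; lia.
- rewrite expr0 mul1r; split => // n n1; rewrite mul1r u1P//; lia.
- have uS (n : nat) : u1 ('X^(m.+1) * P n.+2) = u1 ('X^m * P n.+3) +
      (gamma_coef mu rho n.+1)%:C * u1 ('X^m * P n).
    by rewrite exprSr -mulrA mulX_P mulrDr (scalarD lu1) -scalerAr (scalarZ
      lu1).
  split => [[|[|n]] nm|]; try lia.
    by rewrite uS !IH ?mulr0 ?addr0//; lia.
  rewrite (_ : 2 * m.+1 + 1 = (2 * m + 1).+2)%N; last by lia.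
  by rewrite uS IH ?add0r ?mulf_neq0//; lia.
Qed.

Lemma monic_sequence_P : monic_sequence P.
Proof.
elim/ltn_ind => -[|[|[|n]]] IH.
- by rewrite P0 monic1 size_poly1.
- by rewrite P1 monicX size_polyX.
- by rewrite P2 monicXn size_polyXn.
have [mon sz] := IH n.+2 (ltnSn _).
have sX : size ('X * P n.+2) = n.+4.
  by rewrite mulrC size_mulX -?size_poly_eq0 sz.
have [_ sn] := IH n (ltnW (ltnW (ltnSn _))).
have lt : (size (- ((gamma_coef mu rho n.+1)%:C *: P n)) < size ('X * P
  n.+2)%R)%N.
  by rewrite sX size_polyN (leq_ltn_trans (size_scale_leq _ _))// sn; lia.
rewrite Prec// ; split.
  by rewrite monicE lead_coefDl// mulrC lead_coefMX -monicE.
by rewrite size_polyDl.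
Qed.

Lemma threefold_symmetric_P (w : R[i]) : w ^+ 3 = 1 ->
  forall n x, (P n).[w * x] = w ^+ n * (P n).[x].
Proof.
move=> w3 + x; elim/ltn_ind => -[|[|[|n]]] IH.
- by rewrite P0 !hornerC mulr1.
- by rewrite P1 !hornerX.
- by rewrite P2 !hornerXn exprMn.
rewrite Prec// !(hornerE, hornerZ) !IH//= 2?ltnS; try lia.
rewrite (exprS _ n.+2) !exprSr.
have -> : w * (w ^+ n * w * w) = w ^+ n * w ^+ 3 by ring.
by rewrite w3; ring: w3.
Qed.

End recurrence.

(** * Hypergeometric series at 1 *)

Section kummer.
Context {R : realType}.
Variables (u : R^nat) (kappa : R) (N : nat).
Hypotheses (u0 : forall n, 0 <= u n) (k0 : 0 < kappa).
Hypothesis uN : forall n, (N <= n)%N ->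
  kappa * u n <= n%:R * u n - n.+1%:R * u n.+1.

(** Telescoping of [uN] from [N] on. *)
Let partial_sum_le m :
  kappa * \sum_(N <= k < N + m) u k + (N + m)%:R * u (N + m)%N <= N%:R * u N.
Proof.
elim: m => [|m IH]; first by rewrite addn0 big_geq// mulr0 add0r.
rewrite addnS big_nat_recr ?leq_addr//= mulrDr.
by have := uN (leq_addr m N); lra.
Qed.

Lemma kummer_cvg : cvgn (series u).
Proof.
rewrite -(is_cvg_series_restrict N).
apply: (@near_nondecreasing_is_cvgn _ _ (kappa^-1 * (N%:R * u N))).
  by apply: nearW => n; apply: nondecreasing_series => *; exact: u0.
exists N => // n /= Nn; rewrite -(subnKC Nn) ler_pdivlMl//.
apply: le_trans (partial_sum_le (n - N)).
by rewrite lerDl mulr_ge0.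
Qed.

(** The sequence n u_n is nonnegative and eventually nonincreasing, so it has a limit. A positive
    limit L would give L / (n + 1) <= u_n and make the harmonic series converge. *)
Lemma kummer_cvg0 : (n%:R * u n) @[n --> \oo] --> 0.
Proof.
pose v n := n%:R * u n.
have v0 n : 0 <= v n by rewrite mulr_ge0.
have vS n : (N <= n)%N -> v n.+1 <= v n.
  by move=> Nn; have := uN Nn; have := mulr_ge0 (ltW k0) (u0 n); rewrite /v;
    lra.
have vN n m : (N <= n)%N -> (n <= m)%N -> v m <= v n.
  move=> Nn /subnKC <-; elim: (m - n)%N => [|k]; first by rewrite addn0.
  by apply: le_trans; rewrite addnS vS// (leq_trans Nn)// leq_addr.
have cv : cvgn v.
  apply: (@near_nonincreasing_is_cvgn _ _ 0); last exact: nearW.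
  by exists N => // n /= Nn m nm; exact: vN.
have L0 : 0 <= limn v by apply: limr_ge => //; exact: nearW.
have [L1|L1] := eqVneq (limn v) 0; first by rewrite -L1.
have {}L0 : 0 < limn v by rewrite lt_def L1.
have vL n : (N <= n)%N -> limn v <= v n.
  by move=> Nn; apply: limr_le => //; exists n => // m /= nm; exact: vN.
exfalso; apply: (@dvg_harmonic R); rewrite -(is_cvg_series_restrict N.+1).
apply: (@near_nondecreasing_is_cvgn _ _
    ((limn v)^-1 * (kappa^-1 * (N%:R * u N)))).
  by apply: nearW => n; apply: nondecreasing_series => k _ _; exact:
    harmonic_ge0.
exists N.+1 => // n /= Nn; rewrite ler_pdivlMl// mulr_sumr.
apply: (@le_trans _ _ (\sum_(N.+1 <= k < n) u k)).
  rewrite big_nat_cond [leRHS]big_nat_cond; apply: ler_sum => k; rewrite andbT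
    => /andP[Nk _].
  rewrite ler_pdivrMr//; apply: le_trans (vL k _) _; first exact: ltnW.
  by rewrite /v mulrC ler_wpM2l// ler_nat.
apply: (@le_trans _ _ (\sum_(N <= k < n) u k)).
  by rewrite [leRHS]big_ltn// lerDr.
rewrite ler_pdivlMl// -(subnKC (ltnW Nn)).
by apply: le_trans (partial_sum_le (n - N)); rewrite lerDl mulr_ge0.
Qed.

End kummer.

(** * Convergence, contiguous relation and positivity for the Gauss series *)

Section gauss.
Context {R : realType}.
Implicit Types a b c z : R.

Definition hyp_coef a b c (n : nat) : R :=
  pochhammer a n * pochhammer b n / (pochhammer c n * n`!%:R).

Lemma hyp_coef0 a b c : hyp_coef a b c 0 = 1.
Proof. by rewrite /hyp_coef /pochhammer !big_ord0 fact0 !mul1r invr1. Qed.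

Lemma hyp_coefS a b c n : hyp_coef a b c n.+1 =
  hyp_coef a b c n * ((a + n%:R) * (b + n%:R) / ((c + n%:R) * n.+1%:R)).
Proof.
rewrite /hyp_coef !pochhammerS factS natrM !invfM.
ring.
Qed.

(* The telescoping identity behind all contiguous relations below. *)
Lemma hyp_coef_telescope a b c n : 0 < c ->
  n.+1%:R * hyp_coef a b c n.+1 - n%:R * hyp_coef a b c n =
  hyp_coef a b c n * (a * b - n%:R * (c - a - b)) / (c + n%:R).
Proof.
move=> c0; have n0 : 0 <= n%:R :> R by [].
rewrite hyp_coefS -natr1; field.
by apply/andP; split; apply/eqP; lra.
Qed.

(** With -1 < a the factor a + n is nonnegative from n = 1 on; at n = 0 it may be negative. *)
Lemma normr_hyp_coefS a b c n : -1 < a -> 0 < b -> 0 < c -> (0 < n)%N ->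
  `|hyp_coef a b c n.+1| =
  `|hyp_coef a b c n| * ((a + n%:R) * (b + n%:R) / ((c + n%:R) * n.+1%:R)).
Proof.
move=> a1 b0 c0 n0; have n1 : 1 <= n%:R :> R by rewrite ler1n.
rewrite hyp_coefS normrM [X in _ * X]ger0_norm// divr_ge0// mulr_ge0//; lra.
Qed.

Lemma hyp_coef_kummer a b c : -1 < a -> 0 < b -> 0 < c -> 0 < c - a - b ->
  exists N, forall n, (N <= n)%N ->
    (c - a - b) / 2 * `|hyp_coef a b c n| <=
    n%:R * `|hyp_coef a b c n| - n.+1%:R * `|hyp_coef a b c n.+1|.
Proof.
move=> a1 b0 c0 d0; set d := c - a - b in d0 *.
(* The right-hand side is |h_n| (n d - a b) / (c + n). The fraction tends to d, and it is at least d
   / 2 once n >= K. *)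
pose K := (`|a * b| + c * d) / d * 2.
exists (Num.bound K).+1 => n Kn.
have Kn1 : K <= n%:R.
  have K0 : 0 <= K.
    rewrite mulr_ge0// divr_ge0// ?(ltW d0)//.
    by rewrite addr_ge0// mulr_ge0// ltW.
  rewrite (le_trans (ltW (archi_boundP K0)))// ler_nat; exact: ltnW.
have n0 : 0 <= n%:R :> R by [].
rewrite (normr_hyp_coefS a1 b0 c0)//; last exact: leq_trans Kn.
set h := `|hyp_coef _ _ _ _|; have h0 : 0 <= h by exact: normr_ge0.
rewrite [leRHS](_ : _ = h * ((n%:R * d - a * b) / (c + n%:R))); last first.
  rewrite -natr1 /d; field; by apply/andP; split; apply/eqP; lra.
rewrite mulrC ler_wpM2l// ler_pdivlMr ?ltr_wpDr//.
have : K * d <= n%:R * d by rewrite ler_wpM2r// ltW.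
rewrite /K mulrAC divfK ?gt_eqF// => Kd.
have := ler_norm (a * b); nra.
Qed.

Section at_one.
Variables a b c : R.
Hypotheses (a1 : -1 < a) (b0 : 0 < b) (c0 : 0 < c) (d0 : 0 < c - a - b).

Lemma cvg_norm_hyp_coef : cvgn (series (fun n => `|hyp_coef a b c n|)).
Proof.
have [N hN] := hyp_coef_kummer a1 b0 c0 d0.
by apply: (kummer_cvg _ _ hN) => //; rewrite divr_gt0.
Qed.

Lemma cvg_hyp_coef : cvgn (series (hyp_coef a b c)).
Proof. exact: normed_cvg cvg_norm_hyp_coef. Qed.

Lemma natr_hyp_coef_cvg0 : (n%:R * hyp_coef a b c n) @[n --> \oo] --> 0.
Proof.
have [N hN] := hyp_coef_kummer a1 b0 c0 d0.
apply/norm_cvg0P; under eq_cvg do rewrite normrM normr_nat.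
by apply: (kummer_cvg0 _ _ hN) => //; rewrite divr_gt0.
Qed.

End at_one.

Lemma hyp_coefSc a b c n : 0 < c ->
  hyp_coef a b (c + 1) n = hyp_coef a b c n * (c / (c + n%:R)).
Proof.
move=> c0; have n0 : 0 <= n%:R :> R by [].
have c1 : 0 < c + 1 by lra.
have p0 : pochhammer (c + 1) n != 0 by rewrite gt_eqF// pochhammer_gt0.
have p1 : pochhammer c n != 0 by rewrite gt_eqF// pochhammer_gt0.
have f0 : n`!%:R != 0 :> R by rewrite pnatr_eq0 -lt0n fact_gt0.
have cn : c + n%:R != 0 by apply/eqP; lra.
have E : pochhammer c n * (c + n%:R) = c * pochhammer (c + 1) n.
  by rewrite -pochhammerS pochhammerSl.
rewrite /hyp_coef; apply: (mulIf p0); apply: (mulIf cn); apply: (mulIf p1).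
transitivity (pochhammer a n * pochhammer b n / n`!%:R *
   (pochhammer c n * (c + n%:R))); last rewrite E.
  by field; rewrite f0 p0.
by field; rewrite cn f0 p1.
Qed.

(** The partial sums of the two sides differ by exactly c n h_n, with h_n the coefficients for [c],
    and this tends to 0. *)
Lemma hyp_coef_contiguous a b c :
  -1 < a -> 0 < b -> 0 < c -> 0 < c - a - b ->
  c * (c - a - b) * limn (series (hyp_coef a b c)) =
  (c - a) * (c - b) * limn (series (hyp_coef a b (c + 1))).
Proof.
move=> a1 b0 c0 d0.
have c10 : 0 < c + 1 by lra.
have d10 : 0 < c + 1 - a - b by lra.
have cv := cvg_hyp_coef a1 b0 c0 d0.
have cv1 := cvg_hyp_coef a1 b0 c10 d10.
apply/eqP; rewrite eq_sym -subr_eq0; apply/eqP.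
pose X n := (c - a) * (c - b) * series (hyp_coef a b (c + 1)) n -
  c * (c - a - b) * series (hyp_coef a b c) n.
have XE n : X n = c * (n%:R * hyp_coef a b c n).
  rewrite /X; elim: n => [|n IH].
    by rewrite /series /= !big_geq// mul0r !mulr0 subr0.
  have n0 : 0 <= n%:R :> R by [].
  have := hyp_coef_telescope a b n c0.
  rewrite !seriesSr hyp_coefSc// => T.
  rewrite [RHS](_ : _ = c * (n%:R * hyp_coef a b c n) +
    c * (n.+1%:R * hyp_coef a b c n.+1 - n%:R * hyp_coef a b c n)); last by ring.
  rewrite T -IH /X; field; apply/eqP; lra.
have X1 : X n @[n --> \oo] -->
    (c - a) * (c - b) * limn (series (hyp_coef a b (c + 1))) -
    c * (c - a - b) * limn (series (hyp_coef a b c)).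
  by apply: cvgB; apply: cvgMr.
have X0 : X n @[n --> \oo] --> c * 0.
  under eq_cvg do rewrite XE; apply: cvgMr; exact: natr_hyp_coef_cvg0.
by rewrite mulr0 in X0; apply: cvg_unique X1 X0.
Qed.

(** Negative [a] has to be covered: the weight [calU0] has a = mu / 3 with mu > -1. *)
Lemma hyp_coef_sum_gt0 a b c :
  -1 < a -> 0 < b -> b < c -> 0 < c - a - b ->
  0 < limn (series (hyp_coef a b c)).
Proof.
move=> a1 b0 bc d0; have c0 : 0 < c by lra.
have cv := cvg_hyp_coef a1 b0 c0 d0.
have [a0|a0] := leP 0 a.
  apply: lt_le_trans ltr01 _; apply: limr_ge => //.
  exists 1%N => // -[//|n] _ /=.
  rewrite /series /= big_nat_recl//= hyp_coef0 lerDl sumr_ge0// => k _.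
  rewrite divr_ge0// ?mulr_ge0//; first 1 last.
  - by apply: ltW; exact: pochhammer_gt0.
  - by apply: ltW; exact: pochhammer_gt0.
  - by apply: prodr_ge0 => j _; rewrite addr_ge0.
(* For [a < 0] only the first term is positive; summing the telescoping identity
   as [a S = (c - b) sum_k h_k (a + k) / (c + k)] makes the signs agree. *)
have hS n : hyp_coef a b c n.+1 <= 0.
  elim: n => [|n IH].
    rewrite hyp_coefS hyp_coef0 mul1r !addr0 mulr1 mulr_le0_ge0 ?invr_ge0
      ?(ltW c0)//.
    by rewrite mulr_le0_ge0// ltW.
  have an : 0 <= a + n.+1%:R by have := ler0n R n; rewrite -natr1; lra.
  by rewrite hyp_coefS mulr_le0_ge0// divr_ge0// mulr_ge0// addr_ge0// ltW.
(* This lower bound is the k = 0 term of the rearranged sum divided by [a]; the remaining terms,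
   like n h_n, are nonpositive, and division by a < 0 reverses the inequality. *)
apply: (@lt_le_trans _ _ ((c - b) / c)).
  by rewrite divr_gt0// subr_gt0.
apply: limr_ge => //; exists 1%N => // -[//|n] _ /=.
have E m : a * series (hyp_coef a b c) m = m%:R * hyp_coef a b c m +
    (c - b) * \sum_(0 <= k < m) hyp_coef a b c k * (a + k%:R) / (c + k%:R).
  elim: m => [|m IH]; first by rewrite /series /= !big_geq// mul0r !mulr0 addr0.
  have m0 : 0 <= m%:R :> R by [].
  rewrite seriesSr big_nat_recr//= mulrDr IH mulrDr addrA.
  rewrite -[m.+1%:R * _](subrK (m%:R * hyp_coef a b c m)) hyp_coef_telescope//.
  by field; apply/eqP; lra.
have : a * series (hyp_coef a b c) n.+1 <= (c - b) * (a / c).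
  rewrite E big_nat_recl//= hyp_coef0 mul1r !addr0 mulrDr.
  rewrite addrCA gerDl -[leRHS](addr0 0) lerD//.
    by rewrite mulr_ge0_le0.
  rewrite mulr_ge0_le0 ?subr_ge0 ?(ltW bc)// sumr_le0// => k _.
  have ak : 0 <= a + k.+1%:R by have := ler0n R k; rewrite -natr1; lra.
  by rewrite -mulrA mulr_le0_ge0// divr_ge0// addr_ge0// ltW.
by rewrite mulrCA ler_nM2l.
Qed.

Lemma cvg_hyp_series a b c z : -1 < a -> 0 < b -> 0 < c -> 0 < z < 1 ->
  cvgn (series (fun n => hyp_coef a b c n * z ^+ n)).
Proof.
move=> a1 b0 c0 /andP[z0 z1]; apply: normed_cvg.
(* Kummer's inequality with constant 1 amounts to n^2 (1 - z) + n (c - 1 - z (a + b)) >= c + z a b,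
   which holds for n >= 1 with n (1 - z) >= L. *)
pose L := `|c - 1 - z * (a + b)| + `|c + z * (a * b)|.
have L0 : 0 <= L by rewrite addr_ge0.
have K0 : 0 <= L / (1 - z) by rewrite divr_ge0// subr_ge0 ltW.
apply: (@kummer_cvg _ _ 1 (Num.bound (L / (1 - z))).+1) => // [n|n Kn].
  exact: normr_ge0.
rewrite /=.
have {Kn} [n1 Ln] : (0 < n)%N /\ L <= n%:R * (1 - z).
  split; first by apply: leq_trans Kn.
  rewrite -ler_pdivrMr ?subr_gt0// (le_trans (ltW (archi_boundP K0)))//.
  by rewrite ler_nat ltnW.
rewrite mul1r (normrM (hyp_coef a b c n.+1)) (normrM (hyp_coef a b c n))
  (normr_hyp_coefS a1 b0 c0)// !normrX (gtr0_norm z0) exprS.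
set h := `|hyp_coef _ _ _ _|; have h0 : 0 <= h by exact: normr_ge0.
have zn0 : 0 <= z ^+ n by rewrite exprn_ge0// ltW.
have n11 : 1 <= n%:R :> R by rewrite ler1n.
rewrite [leRHS](_ : _ = h * z ^+ n * ((n%:R * (c + n%:R) - z * ((a + n%:R) *
  (b + n%:R))) / (c + n%:R))); last first.
  by rewrite -natr1; field; apply/andP; split; apply/eqP; lra.
rewrite ler_peMr ?mulr_ge0// ler_pdivlMr; last by lra.
have l1 := ler_norm (- (c - 1 - z * (a + b))).
have l2 := ler_norm (c + z * (a * b)).
rewrite normrN in l1.
have : L * n%:R <= n%:R * (1 - z) * n%:R by rewrite ler_wpM2r//; lra.
rewrite /L in Ln *; set A := `|_| in l1 Ln *; set B := `|_| in l2 Ln *.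
have A0 : 0 <= A by exact: normr_ge0.
have B0 : 0 <= B by exact: normr_ge0.
nra.
Qed.

End gauss.

(** * Improper integrals and series of integrals *)

Section improper_integral.
Context {R : realType}.
Notation mu := lebesgue_measure.
Variables (I : set R) (l r : R^nat) (f F : R -> R).
Hypotheses (openI : open I) (lr : forall n, l n < r n)
  (l_dec : nonincreasing_seq l) (r_inc : nondecreasing_seq r)
  (lr_sub : forall n x, l n <= x <= r n -> I x)
  (lr_cover : forall x, I x -> exists n, l n <= x <= r n)
  (cf : forall x, I x -> {for x, continuous f})
  (dF : forall x, I x -> is_derive x 1 F (f x)).

Let J n := `[l n, r n]%classic.

Let J_bigcup : \bigcup_n J n = I.
Proof.
apply/seteqP; split => [x [n _]|x Ix].
  by rewrite /J/= in_itv /=; exact: lr_sub.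
by have [n lxr] := lr_cover Ix; exists n => //; rewrite /J/= in_itv.
Qed.

Let J_nd : nondecreasing_seq J.
Proof.
move=> m n mn; rewrite subsetEset => x; rewrite /J/= !in_itv/= => /andP[lx xr].
by rewrite (le_trans (l_dec mn) lx) (le_trans xr (r_inc mn)).
Qed.

Let measurableI : measurable I.
Proof. exact: open_measurable openI. Qed.

Let measurable_f : measurable_fun I f.
Proof.
by apply: open_continuous_measurable_fun => // x; rewrite inE; exact: cf.
Qed.

Let JI n : J n `<=` I.
Proof. by rewrite -J_bigcup; exact: bigcup_sup. Qed.

Let FTC_J n : (\int[mu]_(x in J n) (f x)%:E = (F (r n) - F (l n))%:E)%E.
Proof.
have cF x : I x -> {for x, continuous F}.
  move=> Ix; apply/differentiable_continuous/derivable1_diffP.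
  by have [] := dF Ix.
have Il : I (l n) by apply: (@lr_sub n); rewrite lexx ltW.
have Ir : I (r n) by apply: (@lr_sub n); rewrite lexx ltW.
apply: continuous_FTC2 => //.
- apply: continuous_in_subspaceT => x; rewrite inE => xJ.
  exact/cf/(JI xJ).
- split.
  + by move=> x /subset_itv_oo_cc xJ; have [] := dF (JI xJ).
  + exact/cvg_at_right_filter/cF.
  + exact/cvg_at_left_filter/cF.
- move=> x /subset_itv_oo_cc xJ; rewrite derive1E.
  by have [_ ->] := dF (JI xJ).
Qed.

(** Monotone convergence along the intervals [J n], whose integrals are the increments of [F]. *)
Lemma integrable_of_bounded_primitive (M : R) :
  (forall x, I x -> 0 <= f x) -> (forall n, F (r n) - F (l n) <= M) ->
  mu.-integrable I (EFin \o f).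
Proof.
move=> f0 FM; apply/integrableP; split; first exact/measurable_EFinP.
apply: (@le_lt_trans _ _ M%:E); last exact: ltry.
rewrite [leLHS](_ : _ = (\int[mu]_(x in I) (f x)%:E)%E); last first.
  by apply: eq_integral => x; rewrite inE => Ix /=; rewrite ger0_norm// f0.
have mfJ n : measurable_fun (J n) (EFin \o f).
  by apply/measurable_EFinP; apply: measurable_funS measurable_f.
have cv : (\int[mu]_(x in J n) (f x)%:E)%E @[n --> \oo] -->
    (\int[mu]_(x in \bigcup_n J n) (f x)%:E)%E.
  apply: ge0_nondecreasing_set_cvg_integral => // [n|n x Jx].
    exact: measurable_itv.
  by rewrite lee_fin f0//; exact: JI Jx.
rewrite J_bigcup in cv; rewrite -(cvg_lim _ cv)//.
apply: lime_le; first by apply: cvgP cv.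
by apply: nearW => n /=; rewrite FTC_J lee_fin.
Qed.

(** Here [f] may change sign, so dominated convergence with bound |f| replaces monotone
    convergence. *)
Lemma integral_of_primitive (L : R) : mu.-integrable I (EFin \o f) ->
  (F (r n) - F (l n)) @[n --> \oo] --> L ->
  \int[mu]_(x in I) f x = L.
Proof.
move=> intf FL.
have [] := @dominated_convergence _ _ _ mu I measurableI
  (fun n => (EFin \o f) \_ (J n)) (EFin \o f) (abse \o (EFin \o f)).
- move=> n; apply/measurable_restrict => //; first exact: measurable_itv.
  by apply/measurable_EFinP; apply: measurable_funS measurable_f => // x [].
- exact/measurable_EFinP.
- apply/aeW => x Ix; have [n lxr] := lr_cover Ix.
  apply: cvg_near_cst; exists n => // m /= nm.
  rewrite patchE mem_set//.
  have /subsetPset := J_nd nm; apply; by rewrite /J /= in_itv.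
- exact: integrable_abse.
(* Outside [J n] the restriction takes the default value [point], which is 0 here. *)
- apply/aeW => x n Ix; rewrite patchE; case: ifP => // _.
  by rewrite (_ : point = 0%E)// abse0 abse_ge0.
move=> _ _.
rewrite (_ : [sequence _]_n = EFin \o (fun n => F (r n) - F (l n))); last first.
  apply/funext => n /=; rewrite -integral_mkcondr setIidr; last exact: JI.
  exact: FTC_J.
move=> cv; rewrite /Rintegral; apply: (congr1 fine (y := L%:E)).
apply: (cvg_unique _ cv) => //; apply: cvg_EFin; [exact: nearW|exact: FL].
Qed.

End improper_integral.

Section positive_integral.
Context d (T : measurableType d) (R : realType).
Variable m : {measure set T -> \bar R}.

(** A zero integral would force f = 0 almost everywhere on [D], so that [D] would lie in a null
    set. *)
Lemma Rintegral_gt0 (D : set T) (f : T -> R) : measurable D ->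
  m.-integrable D (EFin \o f) -> (forall x, D x -> 0 < f x) ->
  (0 < m D)%E -> 0 < \int[m]_(x in D) f x.
Proof.
move=> mD intf f0 mD0; rewrite lt_def Rintegral_ge0 ?andbT; last first.
  by move=> x Dx; rewrite ltW// f0.
apply/eqP => I0.
have : (\int[m]_(x in D) `|(EFin \o f) x| = 0)%E.
  rewrite -[RHS]/(0%:E) -I0 /Rintegral fineK; last exact: integrable_fin_num.
  by apply: eq_integral => x; rewrite inE => Dx /=; rewrite gtr0_norm// f0.
move/ae_eq_integral_abs => /(_ mD (measurable_int _ intf))[N [mN N0 sub]].
have : (m D <= m N)%E.
  apply: le_measure; rewrite ?inE// => x Dx; apply: sub => /= /(_ Dx) [fx].
  by have := f0 x Dx; rewrite fx ltxx.
by rewrite N0 leNgt mD0.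
Qed.

End positive_integral.

(** * Termwise integration of a series *)

Section series_integral.
Context d (T : measurableType d) (R : realType).
Variable m : {measure set T -> \bar R}.
Variables (D : set T) (g : (T -> R)^nat).
Hypotheses (mD : measurable D)
  (ig : forall n, m.-integrable D (EFin \o g n))
  (sg : cvgn (series (fun n => \int[m]_(x in D) `|g n x|)))
  (pg : forall x, D x -> cvgn (series (g ^~ x))).

Let S x := limn (series (g ^~ x)).

Let mS n : measurable_fun D (fun x => series (g ^~ x) n).
Proof.
apply/measurable_EFinP.
rewrite (_ : _ \o _ = fun x => (\sum_(k < n) (g k x)%:E)%E); last first.
  by apply/funext => x /=; rewrite /series /= big_mkord sumEFin.
apply: emeasurable_sum => k; exact: measurable_int (ig k).
Qed.

Lemma integrable_Rintegral_series : m.-integrable D (EFin \o S) /\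
  series (fun n => \int[m]_(x in D) g n x) @ \oo --> \int[m]_(x in D) S x.
Proof.
(* The dominating function is extended-real valued, since [pg] gives no absolute convergence at a
   point; its integral is the finite sum in [sg]. *)
pose G x := (\sum_(n <oo) `|(g n x)%:E|)%E.
have mabs n : measurable_fun D (fun x => `|(g n x)%:E|%E).
  exact: measurableT_comp (measurable_int _ (ig n)).
have G0 x : (0 <= G x)%E by apply: nneseries_ge0.
have iG : m.-integrable D G.
  apply/integrableP; split; first exact: ge0_emeasurable_sum.
  under eq_integral do rewrite gee0_abs//.
  rewrite integral_nneseries//.
  have E n : (\int[m]_(x in D) `|(g n x)%:E|)%E = (\int[m]_(x in D) `|g n
    x|)%:E.
    rewrite /Rintegral fineK//.
    by apply: integrable_fin_num => //; exact: integrable_norm (ig n).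
  under eq_eseriesr do rewrite E.
  rewrite (_ : (\sum_(_ <oo) _)%E =
     (limn (series (fun n => \int[m]_(x in D) `|g n x|)))%:E) ?ltry//.
  rewrite -EFin_lim//; congr (limn _); apply/funext => n /=.
  by rewrite /series /= -sumEFin.
have [] := @dominated_convergence _ _ _ m D mD
  (fun n x => (series (g ^~ x) n)%:E) (EFin \o S) G.
- by move=> n; apply/measurable_EFinP/mS.
- apply/measurable_EFinP.
  by apply: (measurable_fun_cvg (h := fun n x => series (g ^~ x) n)) => // x
    Dx; exact: pg.
- by apply/aeW => x Dx; apply: cvg_EFin; [exact: nearW|exact: pg].
- exact: iG.
- apply/aeW => x n Dx; rewrite /series /= big_mkord.
  apply: le_trans (nneseries_lim_ge n _) => //.
  by rewrite big_mkord /= sumEFin lee_fin ler_norm_sum.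
move=> iS _ cv; split => //.
have E n : (\int[m]_(x in D) (series (g ^~ x) n)%:E =
    (series (fun n => \int[m]_(x in D) g n x) n)%:E)%E.
  transitivity (\sum_(0 <= k < n) \int[m]_(x in D) (g k x)%:E)%E.
    rewrite -integral_sum//; apply: eq_integral => x _.
    by rewrite /series /= sumEFin.
  rewrite [in RHS]/series /= -sumEFin.
  by apply: eq_bigr => k _; rewrite /Rintegral fineK//; exact:
    integrable_fin_num (ig k).
move: cv; rewrite -[X in _ --> X]fineK; last exact: integrable_fin_num.
rewrite [X in X @ _ --> _](_ : _ = EFin \o series (fun n => \int[m]_(x in D) g
  n x)).
  by move/fine_cvg.
by apply/funext => n /=; exact: E.
Qed.

End series_integral.

(** * Beta integrals *)

Section derive_comp.
Context {R : realType}.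

Lemma is_derive1_comp (f g : R -> R) (x df dg : R) :
  is_derive x 1 f df -> is_derive (f x) 1 g dg ->
  is_derive x 1 (g \o f) (dg * df).
Proof.
move=> [fx <-] [gx <-].
have df1 : differentiable f x by exact/derivable1_diffP.
have dg1 : differentiable g (f x) by exact/derivable1_diffP.
split; first exact/derivable1_diffP/(differentiable_comp df1 dg1).
by have := derive1_comp fx gx; rewrite (derive1E f) (derive1E g) derive1E.
Qed.

End derive_comp.

Section beta_weight.
Context {R : realType}.
Notation mu := lebesgue_measure.
Implicit Types (c x : R) (p n : nat).

(* With [s = x^3], [\int_0^1] of this weight is [B((p + 1) / 3, c) / 3]. *)
Definition beta_weight c p x : R := x ^+ p * (1 - x ^+ 3) `^ (c - 1).

Definition beta_moment c p : R :=
  \int[mu]_(x in `]0, 1[) beta_weight c p x.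

Lemma onem_cube_itv x : 0 < x < 1 -> 0 < 1 - x ^+ 3 < 1.
Proof.
move=> /andP[x0 x1]; rewrite subr_gt0 ltrBlDl ltrDr exprn_gt0// andbT.
by rewrite exprn_ilt1// ltW.
Qed.

Lemma powR_onem_cube c x : 0 < x < 1 ->
  (1 - x ^+ 3) `^ c = (1 - x ^+ 3) `^ (c - 1) * (1 - x ^+ 3).
Proof.
move=> /onem_cube_itv/andP[y0 _].
rewrite -{3}[1 - x ^+ 3]powRr1 ?ltW// -powRD ?subrK//.
by rewrite (gt_eqF y0) implybT.
Qed.

Lemma powR_onem_cube_le1 c x : 0 < c -> 0 < x < 1 -> (1 - x ^+ 3) `^ c <= 1.
Proof.
move=> c0 /onem_cube_itv/andP[y0 y1].
by rewrite -[leRHS](powRr0 (1 - x ^+ 3)) ger_powR ?(ltW c0)// y0 ltW.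
Qed.

(** Serves as a primitive twice: p = 0 gives integrability, and the general case gives the
    recurrence in [p]. For p = 0 the truncated [p.-1] is harmless because of the factor p. *)
Lemma is_derive_beta_weight c p x : 0 < x < 1 ->
  is_derive x 1 (fun y => y ^+ p * (1 - y ^+ 3) `^ c)
    (p%:R * x ^+ p.-1 * (1 - x ^+ 3) `^ c -
     3 * c * x ^+ p.+2 * (1 - x ^+ 3) `^ (c - 1)).
Proof.
move=> /onem_cube_itv/andP[y0 _].
have d1 : is_derive x 1 (fun y : R => 1 - y ^+ 3) (- (3 * x ^+ 2)).
  rewrite (_ : (fun y => _) = cst 1 - (@id R) ^+ 3); last first.
    by apply/funext => y; rewrite /= exprfctE.
  by apply: is_derive_eq; rewrite sub0r /GRing.scale /= mulr1.
have d2 := is_derive1_comp d1 (is_derive1_powR c y0).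
rewrite (_ : (fun y => _) =
    (@id R) ^+ p * ((@powR R) ^~ c \o (fun y : R => 1 - y ^+ 3))); last first.
  by apply/funext => y; rewrite /= exprfctE.
apply: is_derive_eq; rewrite /GRing.scale /= !exprfctE !exprS; ring.
Qed.

Lemma beta_weight_gt0 c p x : 0 < x < 1 -> 0 < beta_weight c p x.
Proof.
move=> /[dup] /andP[x0 _] /onem_cube_itv/andP[y0 _].
by rewrite mulr_gt0 ?exprn_gt0// powR_gt0.
Qed.

Lemma continuous_beta_weight c p x : 0 < x < 1 ->
  {for x, continuous (beta_weight c p)}.
Proof.
move=> x01; apply/differentiable_continuous/derivable1_diffP.
by have [] := is_derive_beta_weight (c - 1) p x01.
Qed.

(** Exhaustion of ]0, 1[; the offset 3 keeps [l n] strictly below 1/2, hence below [r n]. *)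
Let l n : R := n.+3%:R^-1.
Let r n : R := 1 - n.+3%:R^-1.

Let l_gt0 n : 0 < l n. Proof. by rewrite invr_gt0. Qed.

Let l_lt n : l n < 2^-1.
Proof. by rewrite ltf_pV2 ?posrE// ltr_nat. Qed.

Let lr n : l n < r n.
Proof. by have := l_lt n; rewrite /r -/(l n); lra. Qed.

Let l_dec : nonincreasing_seq l.
Proof. by move=> m n mn; rewrite lef_pV2 ?posrE// ler_nat. Qed.

Let r_inc : nondecreasing_seq r.
Proof. by move=> m n mn; rewrite lerD2l lerN2; exact: l_dec. Qed.

Let lr_sub n (x : R) : l n <= x <= r n -> `]0, 1[%classic x.
Proof.
have := l_gt0 n; rewrite /= in_itv /= /r -/(l n) => l0 /andP[lx xr].
by apply/andP; split; lra.
Qed.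

Let l_cvg0 : l n @[n --> \oo] --> 0.
Proof.
rewrite (_ : (fun n => l n) = [sequence harmonic (n + 2)%N]_n).
  by rewrite cvg_shiftn; exact: cvg_harmonic.
by apply/funext => n; rewrite /l /= addn2.
Qed.

Let lr_cover (x : R) : `]0, 1[%classic x -> exists n, l n <= x <= r n.
Proof.
rewrite /= in_itv /= => /andP[x0 x1].
have e0 : 0 < Num.min x (1 - x) by rewrite lt_min x0 subr_gt0.
have /cvgrPdist_le /(_ _ e0) [n _ /(_ n (leqnn n))] := l_cvg0.
rewrite /= sub0r normrN gtr0_norm// le_min => /andP[h1 h2]; exists n.
by rewrite h1 /r -/(l n) lerBrDl addrC -lerBrDl.
Qed.

Let open01 : open (`]0, 1[%classic : set R). Proof. exact: interval_open. Qed.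

Let in01 (x : R) : `]0, 1[%classic x -> 0 < x < 1.
Proof. by rewrite /= in_itv. Qed.

(** For p = 2 the weight has the bounded primitive -(1 - x^3)^c / (3c); every other [p] is dominated
    by 1 plus that weight. *)
Lemma integrable_beta_weight c p : 0 < c ->
  mu.-integrable `]0, 1[ (EFin \o beta_weight c p).
Proof.
move=> c0.
have i2 : mu.-integrable `]0, 1[ (EFin \o beta_weight c 2).
  apply: (integrable_of_bounded_primitive (F := fun x => (-(3 * c))^-1 *
      (x ^+ 0 * (1 - x ^+ 3) `^ c)) (M := (3 * c)^-1)
      open01 lr l_dec r_inc lr_sub lr_cover _ _).
  - by move=> x /in01; exact: continuous_beta_weight.
  - move=> x /in01 x01; have d := is_derive_beta_weight c 0 x01.
    apply: (@is_derive_eq _ _ _ ((-(3 * c))^-1 \*: (fun x => x ^+ 0 * (1 - x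
      ^+ 3) `^ c))).
    by rewrite /GRing.scale /= /beta_weight; field; apply/eqP; lra.
  - by move=> x /in01 x01; rewrite ltW// beta_weight_gt0.
  - move=> n; rewrite !expr0 !mul1r invrN !mulNr opprK addrC -mulrBr.
    rewrite ler_piMr ?invr_ge0 ?mulr_ge0 ?(ltW c0)//.
    rewrite lerBlDr (@le_trans _ _ 1)//; last first.
      by rewrite lerDl powR_ge0.
    apply: powR_onem_cube_le1 => //; apply: in01.
    by apply: (@lr_sub n); rewrite lexx ltW.
have mw : measurable_fun (`]0, 1[%classic : set R) (beta_weight c p).
  apply: open_continuous_measurable_fun => // x; rewrite inE => /in01.
  exact: continuous_beta_weight.
(* (1 - x^3)^(c-1) = (1 - x^3)^c + x^3 (1 - x^3)^(c-1) with (1 - x^3)^c <= 1. *)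
apply: (@le_integrable _ _ _ mu _ _ _ (EFin \o (fun x => 1 + beta_weight c 2
  x))).
- exact: measurable_itv.
- exact/measurable_EFinP.
- move=> x /in01 x01 /=; rewrite lee_fin.
  rewrite !ger0_norm ?addr_ge0 ?(ltW (beta_weight_gt0 _ _ x01))//.
  have /andP[y0 y1] := onem_cube_itv x01.
  have /andP[x0 x1] := x01.
  set q := (1 - x ^+ 3) `^ (c - 1).
  have q0 : 0 <= q by exact: powR_ge0.
  have qc : q * (1 - x ^+ 3) <= 1.
    by rewrite -powR_onem_cube// powR_onem_cube_le1.
  have xp : x ^+ p <= 1 by rewrite exprn_ile1// ltW.
  rewrite /beta_weight -/q; apply: (@le_trans _ _ q).
    by rewrite ler_piMl.
  have x2 : x ^+ 3 <= x ^+ 2 by rewrite exprS ler_piMl ?exprn_ge0// ltW.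
  have : q * x ^+ 3 <= q * x ^+ 2 by rewrite ler_wpM2l.
  by rewrite [_ * q]mulrC; lra.
- have i1 : mu.-integrable `]0, 1[ (EFin \o cst (1 : R)).
    apply: measurable_bounded_integrable => //.
      by rewrite /= lebesgue_measure_itv /= lte01 oppr0 adde0 ltry.
    exact: bounded_cst.
  by apply: eq_integrable (integrableD _ i1 i2).
Qed.

Lemma beta_moment_gt0 c p : 0 < c -> 0 < beta_moment c p.
Proof.
move=> c0; apply: Rintegral_gt0.
- exact: measurable_itv.
- exact: integrable_beta_weight.
- by move=> x /in01; exact: beta_weight_gt0.
- by rewrite /= lebesgue_measure_itv /= lte01 oppr0 adde0 lte01.
Qed.

(** The difference of the two sides integrates the derivative of x^(p + 1) (1 - x^3)^c, which
    vanishes at both end points. *)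
Lemma beta_momentDp c p : 0 < c ->
  (p.+1%:R + 3 * c) * beta_moment c (p + 3) = p.+1%:R * beta_moment c p.
Proof.
move=> c0; apply/eqP; rewrite eq_sym -subr_eq0; apply/eqP.
have ip := integrable_beta_weight p c0.
have ip3 := integrable_beta_weight (p + 3) c0.
rewrite /beta_moment -!RintegralZl// -RintegralB//; last 2 first.
- exact: (integrableZl _ _ ip).
- exact: (integrableZl _ _ ip3).
apply: (integral_of_primitive
  (F := fun x => x ^+ p.+1 * (1 - x ^+ 3) `^ c)
  open01 lr l_dec r_inc lr_sub lr_cover).
- move=> x /in01 x01; apply: cvgB; apply: cvgMr; exact: continuous_beta_weight.
- move=> x /in01 x01; have := is_derive_beta_weight c p.+1 x01.
  move/is_derive_eq; apply; rewrite powR_onem_cube// /beta_weight addn3 /=.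
  rewrite !exprS; ring.
- by apply: (integrableB _ (integrableZl _ _ ip) (integrableZl _ _ ip3)).
have Fl : (l n) ^+ p.+1 * (1 - (l n) ^+ 3) `^ c @[n --> \oo] --> 0.
  apply: (squeeze_cvgr _ (cvg_cst 0) l_cvg0); apply: nearW => n.
  have l01 : 0 < l n < 1.
    by apply/in01/(@lr_sub n); rewrite lexx ltW.
  have /andP[l0 l1] := l01; have /andP[y0 y1] := onem_cube_itv l01.
  rewrite mulr_ge0 ?powR_ge0 ?exprn_ge0 ?(ltW l0)//=.
  rewrite exprS -mulrA ler_piMr ?(ltW l0)// mulr_ile1 ?powR_ge0 ?exprn_ge0
    ?(ltW l0)//.
    by rewrite exprn_ile1// ltW.
  exact: powR_onem_cube_le1.
(* Controls the right end: with t = [l n], 1 - (1 - t)^3 <= 3t. *)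
have pl : (3 * l n) `^ c @[n --> \oo] --> 0.
  have /cvg_at_rightP := @powR_cvg0 R c c0.
  move=> /(_ (fun n => 3 * l n)); apply; split; first by move=> n; rewrite
    mulr_gt0.
  by rewrite -[X in _ --> X](mulr0 3); exact: cvgMr.
have Fr : (r n) ^+ p.+1 * (1 - (r n) ^+ 3) `^ c @[n --> \oo] --> 0.
  apply: (squeeze_cvgr _ (cvg_cst 0) pl); apply: nearW => n.
  have l01 : 0 < r n < 1.
    by apply/in01/(@lr_sub n); rewrite lexx ltW.
  have /andP[l0 l1] := l01; have /andP[y0 y1] := onem_cube_itv l01.
  rewrite mulr_ge0 ?powR_ge0 ?exprn_ge0 ?(ltW l0)//=.
  apply: (@le_trans _ _ ((1 - r n ^+ 3) `^ c)).
    by rewrite ler_piMl ?powR_ge0// exprn_ile1// ltW.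
  apply: ge0_ler_powR; rewrite ?nnegrE ?(ltW c0) ?(ltW y0)//.
    by rewrite mulr_ge0// ltW.
  rewrite /r -/(l n); have := l_gt0 n; have := l_lt n.
  by set t := l n => t2 t0; rewrite !exprS expr0; nra.
by rewrite -[X in _ --> X](subr0 0); exact: cvgB.
Qed.

Lemma beta_momentDc c p : 0 < c ->
  (p.+1%:R + 3 * c) * beta_moment (c + 1) p = 3 * c * beta_moment c p.
Proof.
move=> c0.
have ip := integrable_beta_weight p c0.
have ip3 := integrable_beta_weight (p + 3) c0.
have -> : beta_moment (c + 1) p = beta_moment c p - beta_moment c (p + 3).
  rewrite /beta_moment -RintegralB//.
  apply: eq_Rintegral => x; rewrite inE => /in01 x01.
  by rewrite /beta_weight addrK powR_onem_cube// exprD; ring.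
by rewrite mulrBr beta_momentDp//; ring.
Qed.

Lemma beta_momentDn c p n : 0 < c ->
  beta_moment (c + n%:R) p =
  beta_moment c p * (pochhammer c n / pochhammer (p.+1%:R / 3 + c) n).
Proof.
move=> c0; elim: n => [|n IH].
  by rewrite /pochhammer !big_ord0 divr1 mulr1 addr0.
have n0 : 0 <= n%:R :> R by []. have p0 : 0 < p.+1%:R :> R by [].
have q0 : 0 < p.+1%:R / 3 + c by rewrite addr_gt0// divr_gt0.
have Q : pochhammer (p.+1%:R / 3 + c) n != 0 by rewrite gt_eqF// pochhammer_gt0.
have nz : p.+1%:R + 3 * (c + n%:R) != 0 by apply/eqP; lra.
apply: (mulfI nz); rewrite -(natr1 n) addrA beta_momentDc; last by lra.
rewrite IH !pochhammerS; move: (p.+1%:R) p0 q0 Q nz => t p0 q0 Q nz.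
by field; rewrite Q andbT; apply/eqP; lra.
Qed.

End beta_weight.

(** * Gamma factors and hypergeometric moments *)

Section gamma_positive.
Context {R : realType}.
Notation mu := lebesgue_measure.
Implicit Type x : R.
Variable s : R.
Hypothesis s0 : 0 < s.

Let l n : R := n.+2%:R^-1.
Let r n : R := n.+2%:R.

Let l_gt0 n : 0 < l n. Proof. by rewrite invr_gt0. Qed.

Let lr n : l n < r n.
Proof.
apply: (@lt_trans _ _ 1); last by rewrite /r ltr1n.
by rewrite invf_lt1// ltr1n.
Qed.

Let l_dec : nonincreasing_seq l.
Proof. by move=> m n mn; rewrite lef_pV2 ?posrE// ler_nat. Qed.

Let r_inc : nondecreasing_seq r.
Proof. by move=> m n mn; rewrite ler_nat. Qed.

Let lr_sub n (x : R) : l n <= x <= r n -> `]0, +oo[%classic x.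
Proof.
by move=> /andP[lx _]; rewrite /= in_itv /= andbT (lt_le_trans (l_gt0 n)).
Qed.

Let lr_cover (x : R) : `]0, +oo[%classic x -> exists n, l n <= x <= r n.
Proof.
rewrite /= in_itv /= andbT => x0.
have y0 : 0 <= x + x^-1 by rewrite addr_ge0 ?invr_ge0 ?ltW.
exists (Num.bound (x + x^-1)); rewrite /l /r.
have := archi_boundP y0; set N := Num.bound _ => xN.
have NN : N%:R <= N.+2%:R :> R by rewrite ler_nat ltnW.
have xi0 : 0 < x^-1 by rewrite invr_gt0.
rewrite (_ : x <= _); last by lra.
by rewrite andbT -[leRHS]invrK lef_pV2 ?posrE//; lra.
Qed.

Let open0y : open (`]0, +oo[%classic : set R). Proof. exact: interval_open. Qed.

Let in0y (x : R) : `]0, +oo[%classic x -> 0 < x.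
Proof. by rewrite /= in_itv /= andbT. Qed.

(* Up to a constant, [h] dominates the integrand of [Gamma s]; its primitive
   [- 1 / (s (1 + x^s))] is bounded. *)
Let h x : R := x `^ (s - 1) / ((1 + x `^ s) * (1 + x `^ s)).

Let is_derive_h x : 0 < x ->
  is_derive x 1 (fun x => - (s * (1 + x `^ s))^-1) (h x).
Proof.
move=> x0; have d := is_derive1_powR s x0.
have y0 : 0 < 1 + x `^ s by rewrite ltr_pwDl// powR_ge0.
have d2 : is_derive x 1 (fun y => s * (1 + y `^ s)) (s * (s * x `^ (s - 1))).
  rewrite (_ : (fun y => _) = s \*: (cst 1 + (@powR R)^~ s))//.
  by apply: is_derive_eq; rewrite add0r.
have sy0 : s * (1 + x `^ s) != 0 by rewrite gt_eqF// mulr_gt0.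
have [dv1 dv2] := d2.
have d3 : is_derive x 1 (fun y => (s * (1 + y `^ s))^-1)
    (- (s * (1 + x `^ s)) ^- 2 *: (s * (s * x `^ (s - 1)))).
  by split; [exact: derivableV|rewrite deriveV// dv2].
apply: (is_derive_eq (is_deriveN d3)); rewrite /h /GRing.scale /=.
by field; rewrite !gt_eqF.
Qed.

Let continuous_h x : 0 < x -> {for x, continuous h}.
Proof.
move=> x0.
have cp a : {for x, continuous (fun y => y `^ a)}.
  apply/differentiable_continuous/derivable1_diffP.
  by have [] := is_derive1_powR a x0.
have y0 : 0 < 1 + x `^ s by rewrite ltr_pwDl// powR_ge0.
apply: cvgM; first exact: cp.
apply: cvgV; first by rewrite gt_eqF// mulr_gt0.
by apply: cvgM; apply: cvgD; [exact: cvg_cst|exact: cp|exact: cvg_cst|exact: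
  cp].
Qed.

Let integrable_h : mu.-integrable `]0, +oo[ (EFin \o h).
Proof.
apply: (integrable_of_bounded_primitive
  (F := fun x => - (s * (1 + x `^ s))^-1) (M := s^-1)
  open0y lr l_dec r_inc lr_sub lr_cover _ _).
- by move=> x /in0y; exact: continuous_h.
- by move=> x /in0y; exact: is_derive_h.
- by move=> x _; rewrite mulr_ge0 ?powR_ge0 ?invr_ge0 -?expr2 ?sqr_ge0.
- move=> n; have y1 z : 1 <= 1 + z `^ s by rewrite lerDl powR_ge0.
  rewrite opprK (@le_trans _ _ ((s * (1 + l n `^ s))^-1))//.
    rewrite gerDr oppr_le0 invr_ge0 mulr_ge0 ?(ltW s0)//.
    exact: le_trans (y1 _).
  rewrite lef_pV2 ?posrE ?mulr_gt0 ?(lt_le_trans ltr01 (y1 _))//.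
  by rewrite ler_peMr// ltW.
Qed.

(** It suffices to bound (1 + x^s)^2 by K e^x. For an integer m >= s, 1 + x^s <= 2 (1 + x)^m and 1 +
    x <= 2m e^(x / 2m), whence K = 4 (2m)^(2m). *)
Let gamma_le_h : exists2 K, 0 <= K &
  forall x, 0 < x -> x `^ (s - 1) * expR (- x) <= K * h x.
Proof.
pose m := (Num.bound s).+1.
have sm : s <= m%:R.
  by rewrite (le_trans (ltW (archi_boundP (ltW s0))))// ler_nat.
have m0 : 0 < (2 * m)%:R :> R by rewrite ltr0n.
exists (4 * (2 * m)%:R ^+ (2 * m)); first by rewrite mulr_ge0 ?exprn_ge0 ?ltW.
move=> x x0; have y0 : 0 < 1 + x `^ s by rewrite ltr_pwDl// powR_ge0.
rewrite /h -expr2 mulrCA ler_wpM2l ?powR_ge0// ler_pdivlMr ?exprn_gt0//.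
rewrite expRN ler_pdivrMl ?expR_gt0// [leRHS]mulrC.
have x1 : 1 <= 1 + x by rewrite lerDl ltW.
have h1 : 1 + x `^ s <= 2 * (1 + x) ^+ m.
  have a1 : 1 <= (1 + x) ^+ m by rewrite exprn_ege1.
  have a2 : x `^ s <= (1 + x) ^+ m.
    rewrite (@le_trans _ _ ((1 + x) `^ s))//.
      by rewrite ge0_ler_powR ?nnegrE ?(ltW s0) ?(ltW x0)//; lra.
    by rewrite -powR_mulrn; [exact: ler_powR|lra].
  lra.
have h2 : 1 + x <= (2 * m)%:R * expR (x / (2 * m)%:R).
  have := expR_ge1Dx (x / (2 * m)%:R) => /(ler_wpM2l (ltW m0)).
  apply: le_trans; rewrite mulrDr mulr1 mulrCA divff ?gt_eqF// mulr1 lerD2r.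
  by rewrite ler1n.
apply: (@le_trans _ _ ((2 * (1 + x) ^+ m) ^+ 2)).
  by rewrite lerXn2r ?nnegrE ?(ltW y0)// (le_trans (ltW y0)).
rewrite exprMn -exprM mulnC -[leRHS]mulrA (_ : 2 ^+ 2 = 4); last by ring.
rewrite ler_wpM2l//.
apply: (@le_trans _ _ (((2 * m)%:R * expR (x / (2 * m)%:R)) ^+ (2 * m))).
  by rewrite lerXn2r ?nnegrE ?mulr_ge0 ?expR_ge0 ?(ltW m0)//; lra.
by rewrite exprMn -expRM_natr divfK ?gt_eqF.
Qed.

(** The substance is integrability: an infinite integral would be sent to 0 by the real-valued
    integral. *)
Lemma Gamma_gt0 : 0 < Gamma s.
Proof.
have cg x : 0 < x -> {for x, continuous (fun x => x `^ (s - 1) * expR (- x))}.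
  move=> x0; have cp : {for x, continuous (fun y => y `^ (s - 1))}.
    apply/differentiable_continuous/derivable1_diffP.
    by have [] := is_derive1_powR (s - 1) x0.
  have ce : {for x, continuous (fun y : R => expR (- y))}.
    by apply: continuous_comp; [exact: opp_continuous|exact: continuous_expR].
  by apply: cvgM; [exact: cp|exact: ce].
apply: Rintegral_gt0.
- exact: measurable_itv.
- have [K K0 Kh] := gamma_le_h.
  apply: (@le_integrable _ _ _ mu _ _ _ (fun x => K%:E * (EFin \o h) x)%E).
  + exact: measurable_itv.
  + apply/measurable_EFinP; apply: open_continuous_measurable_fun => //.
    by move=> x; rewrite inE => /in0y; exact: cg.
  + move=> x /in0y x0 /=; rewrite lee_fin.
    have hx0 : 0 <= h x by rewrite mulr_ge0 ?powR_ge0 ?invr_ge0 -?expr2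
      ?sqr_ge0.
    have n1 : 0 <= x `^ (s - 1) * expR (- x) by rewrite mulr_ge0 ?powR_ge0
      ?expR_ge0.
    have n2 : 0 <= K * h x by exact: mulr_ge0.
    by rewrite (ger0_norm n1) (ger0_norm n2); exact: Kh.
  + exact: (integrableZl _ _ integrable_h).
- by move=> x /in0y x0; rewrite mulr_gt0 ?powR_gt0 ?expR_gt0.
- by rewrite /= lebesgue_measure_itv /= !ltry.
Qed.

End gamma_positive.

(** * Moments of hypergeometric weights as Gauss series at 1 *)

Section hypergeometric_moment.
Context {R : realType}.
Notation mu := lebesgue_measure.
Implicit Type x : R.
Variables (a b c : R) (p : nat).
Hypotheses (a1 : -1 < a) (b0 : 0 < b) (c0 : 0 < c).

Definition hyp_weight x : R :=
  x ^+ p * ((1 - x ^+ 3) `^ (c - 1) * hyp2F1 a b c (1 - x ^+ 3)).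

Let C := p.+1%:R / 3 + c.

Hypothesis d0 : 0 < C - a - b.

Let C0 : 0 < C. Proof. by rewrite addr_gt0// divr_gt0. Qed.

(** The [n]-th term of the expanded weight, with (1 - x^3)^n absorbed into the exponent. *)
Let g n x := hyp_coef a b c n * beta_weight (c + n%:R) p x.

Let in01 (x : R) : `]0, 1[%classic x -> 0 < x < 1.
Proof. by rewrite /= in_itv. Qed.

Let cn0 n : 0 < c + n%:R. Proof. by rewrite ltr_wpDr. Qed.

Let gE x : 0 < x < 1 ->
  g ^~ x = beta_weight c p x *: (fun n => hyp_coef a b c n * (1 - x ^+ 3) ^+ n).
Proof.
move=> /onem_cube_itv/andP[y0 _]; apply/funext => n.
rewrite /g /beta_weight (_ : c + n%:R - 1 = (c - 1) + n%:R); last by ring.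
rewrite powRD; last by rewrite (gt_eqF y0) implybT.
by rewrite powR_mulrn ?(ltW y0)// [RHS]mulrCA !mulrA [_ * x ^+ p]mulrC.
Qed.

(** Integration replaces (c)_n by (C)_n in the denominator; the series in 1 - x^3 with parameter [c]
    becomes the series at 1 with parameter [C]. *)
Let coef_moment n : hyp_coef a b c n * beta_moment (c + n%:R) p =
  beta_moment c p * hyp_coef a b C n.
Proof.
have pc : pochhammer c n != 0 by rewrite gt_eqF// pochhammer_gt0.
have pC : pochhammer C n != 0 by rewrite gt_eqF// pochhammer_gt0.
have nf : n`!%:R != 0 :> R by rewrite pnatr_eq0 -lt0n fact_gt0.
rewrite beta_momentDn// -/C /hyp_coef; field.
by rewrite pc pC nf.
Qed.

Let ig n : mu.-integrable `]0, 1[ (EFin \o g n).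
Proof. exact: (integrableZl _ _ (integrable_beta_weight p (cn0 n))). Qed.

Let moment_g n : \int[mu]_(x in `]0, 1[) g n x =
  beta_moment c p * hyp_coef a b C n.
Proof.
by rewrite RintegralZl ?coef_moment//; exact: integrable_beta_weight.
Qed.

Let moment_norm_g n : \int[mu]_(x in `]0, 1[) `|g n x| =
  beta_moment c p * `|hyp_coef a b C n|.
Proof.
transitivity (\int[mu]_(x in `]0, 1[)
    (`|hyp_coef a b c n| * beta_weight (c + n%:R) p x)).
  apply: eq_Rintegral => x; rewrite inE => /in01 x01.
  by rewrite normrM [X in _ * X]gtr0_norm// beta_weight_gt0.
rewrite RintegralZl//; last exact: integrable_beta_weight.
rewrite -[beta_moment c p]gtr0_norm; last exact: beta_moment_gt0.
rewrite -normrM -coef_moment (normrM (hyp_coef a b c n)); congr (_ * _).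
by rewrite gtr0_norm// beta_moment_gt0.
Qed.

Let lim_g x : 0 < x < 1 ->
  cvgn (series (g ^~ x)) /\ limn (series (g ^~ x)) = hyp_weight x.
Proof.
move=> x01; have cv := cvg_hyp_series a1 b0 c0 (onem_cube_itv x01).
rewrite (gE x01); split; first exact: is_cvg_seriesZ.
by rewrite lim_seriesZ// /hyp_weight /beta_weight /GRing.scale /= -mulrA.
Qed.

Let moments : mu.-integrable `]0, 1[ (EFin \o (fun x => limn (series (g ^~
  x)))) /\
  series (fun n => \int[mu]_(x in `]0, 1[) g n x) @ \oo -->
  \int[mu]_(x in `]0, 1[) limn (series (g ^~ x)).
Proof.
apply: integrable_Rintegral_series => //.
- rewrite (_ : (fun n => _) = beta_moment c p *: (fun n => `|hyp_coef a b C
    n|)).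
    by apply: is_cvg_seriesZ; exact: cvg_norm_hyp_coef.
  by apply/funext => n; rewrite moment_norm_g.
- by move=> x /in01 /lim_g[].
Qed.

Lemma integrable_hyp_weight : mu.-integrable `]0, 1[ (EFin \o hyp_weight).
Proof.
apply: eq_integrable moments.1 => //= x; rewrite inE => /in01 /lim_g[_ ->//].
Qed.

Lemma hyp_momentE : \int[mu]_(x in `]0, 1[) hyp_weight x =
  beta_moment c p * limn (series (hyp_coef a b C)).
Proof.
have [_ cv] := moments.
transitivity (\int[mu]_(x in `]0, 1[) limn (series (g ^~ x))).
  by apply: eq_Rintegral => x; rewrite inE => /in01 /lim_g[_ ->].
apply: (cvg_unique _ cv) => //.
rewrite (_ : (fun n => _) = beta_moment c p *: hyp_coef a b C); last first.
  by apply/funext => n; rewrite moment_g.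
rewrite seriesZ; apply: cvgZr; exact: cvg_hyp_coef.
Qed.

End hypergeometric_moment.

Section hypergeometric_moment_recurrence.
Context {R : realType}.
Notation mu := lebesgue_measure.
Variables (a b c : R).
Hypotheses (a1 : -1 < a) (b0 : 0 < b) (c0 : 0 < c).

Definition hyp_moment p : R := \int[mu]_(x in `]0, 1[) hyp_weight a b c p x.

(** Raising [p] by 3 raises C = s + c by 1: the beta factor gains s / C, and the contiguous relation
    gives the ratio of the series. *)
Lemma hyp_momentD3 p (s := p.+1%:R / 3) : 0 < s + c - a - b ->
  (s + c - a) * (s + c - b) * hyp_moment (p + 3) =
  s * (s + c - a - b) * hyp_moment p.
Proof.
move=> d0; have s0 : 0 < s by rewrite divr_gt0.
have E : (p + 3).+1%:R / 3 + c = s + c + 1.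
  by rewrite -addSn natrD /s; field.
have d1 : 0 < (p + 3).+1%:R / 3 + c - a - b by rewrite E; clearbody s; lra.
have C0 : 0 < s + c by exact: addr_gt0.
rewrite /hyp_moment !hyp_momentE// E -/s.
have := hyp_coef_contiguous a1 b0 C0 d0.
have := beta_momentDp p c0.
set S := limn _; set S1 := limn _; set B3 := beta_moment _ _; set B :=
  beta_moment _ _.
rewrite (_ : p.+1%:R = 3 * s); last by rewrite /s; field.
move=> H1 H2.
have n3 : (3 : R) != 0 by apply/eqP; lra.
have H1' : B3 * (s + c) = s * B.
  apply: (mulfI n3); transitivity ((3 * s + 3 * c) * B3); first by ring.
  by rewrite H1; ring.
have nz : s + c != 0 by rewrite gt_eqF.
apply: (mulfI nz).
rewrite (_ : (s + c) * _ = (B3 * (s + c)) * ((s + c - a) * (s + c - b) * S1));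
  last by ring.
by rewrite H1' -H2; ring.
Qed.

Lemma hyp_moment_gt0 p (s := p.+1%:R / 3) : b < s + c -> 0 < s + c - a - b ->
  0 < hyp_moment p.
Proof.
move=> bs d0; rewrite /hyp_moment hyp_momentE// mulr_gt0//.
  exact: beta_moment_gt0.
exact: hyp_coef_sum_gt0.
Qed.

End hypergeometric_moment_recurrence.

(** * Functionals on the three rays *)

Section Rintegral_linear.
Context d (T : measurableType d) (R : realType).
Variable m : {measure set T -> \bar R}.
Variables (D : set T) (n : nat) (a : nat -> R) (g : nat -> T -> R).
Hypotheses (mD : measurable D)
  (ig : forall i, m.-integrable D (EFin \o g i)).

Lemma integrable_linear :
  m.-integrable D (EFin \o (fun x => \sum_(i < n) a i * g i x)).
Proof.
rewrite (_ : _ \o _ = fun x => (\sum_(i < n) (a i)%:E * (EFin \o g i) x)%E).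
  by apply: integrable_sum => // i _; exact: integrableZl.
by apply/funext => x /=; rewrite -sumEFin.
Qed.

Lemma Rintegral_linear :
  \int[m]_(x in D) (\sum_(i < n) a i * g i x) =
  \sum_(i < n) a i * \int[m]_(x in D) g i x.
Proof.
rewrite /Rintegral.
transitivity (fine (\sum_(i < n) \int[m]_(x in D) ((a i)%:E * (g i x)%:E))%E).
  congr fine; rewrite -integral_sum//.
    by apply: eq_integral => x _; rewrite -sumEFin.
  by move=> i; exact: (integrableZl mD (a i) (ig i)).
rewrite -sum_fine; last first.
  move=> i _; apply: integrable_fin_num => //.
  exact: (integrableZl mD (a i) (ig i)).
apply: eq_bigr => i _; rewrite (integralZl mD (ig i)) fineM//.
exact: integrable_fin_num (ig i).
Qed.

End Rintegral_linear.

(** * The primitive cube root of unity *)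

Section omega.
Context {R : realType}.

Lemma omega3 : (omega : R[i]) ^+ 3 = 1.
Proof.
set t : R := 2 * pi / 3.
have -> : omega ^+ 3 = cos (t + (t + t)) +i* sin (t + (t + t)) :> R[i].
  rewrite exprS expr2 /omega -/t.
  by apply/eqP; rewrite eq_complex /= !(cosD, sinD); apply/andP; split;
    apply/eqP; ring.
have -> : t + (t + t) = pi *+ 2 by rewrite /t mulr2n; field.
by rewrite cos2pi sin2pi.
Qed.

Lemma omega_neq0 : (omega : R[i]) != 0.
Proof.
by apply/eqP => w0; have := omega3; rewrite w0 expr0n /= => /esym/eqP; rewrite
  oner_eq0.
Qed.

Lemma omega_neq1 : (omega : R[i]) != 1.
Proof.
apply/eqP => /(congr1 (@complex.Im R)) /= s0.
have : 0 < sin (2 * pi / 3 : R).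
  by apply: sin_gt0_pi; have := @pi_gt0 R; lra.
by rewrite s0 ltxx.
Qed.

(** Root-of-unity filter, reduced to n mod 3. *)
Lemma omega_sum n : 1 + omega ^+ n + (omega ^+ n) ^+ 2 =
  (if (3 %| n)%N then 3 else 0 : R[i]).
Proof.
have w0 : 1 + omega + omega ^+ 2 = 0 :> R[i].
  have w1 : omega - 1 != 0 :> R[i] by rewrite subr_eq0 omega_neq1.
  apply: (mulfI w1); rewrite mulr0.
  by transitivity (omega ^+ 3 - 1 : R[i]); [ring|rewrite omega3 subrr].
have wm k r : omega ^+ (k * 3 + r) = omega ^+ r :> R[i].
  by rewrite exprD mulnC exprM omega3 expr1n mul1r.
rewrite (divn_eq n 3) wm; have := ltn_pmod n (isT : 0 < 3)%N.
rewrite dvdn_addr ?dvdn_mull//.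
case: (n %% 3)%N => [|[|[|//]]] _ /=.
- by rewrite expr0; ring.
- by rewrite expr1.
- rewrite -exprM (wm 1 1)%N expr1 -w0; ring.
Qed.

End omega.

(** * Ray functionals in terms of real moments *)

Section ray_moments.
Context {R : realType}.
Notation mu := lebesgue_measure.
Variable U : R -> R.
Hypothesis iU : forall i,
  mu.-integrable `]0, 1[ (EFin \o (fun t : R => t ^+ i * U t)).

Definition moment i : R := \int[mu]_(t in `]0, 1[) (t ^+ i * U t).

Implicit Type f : {poly R[i]}.

(** On the ray x = omega^j t, x^i contributes omega^(ji) and dx contributes one more omega^j. *)
Let coef f j i : R[i] := f`_i * omega ^+ (j * i.+1).

Let integrandE f j t :
  segment_integrand (omega ^+ j) (ray_integrand U f j) t =
  \sum_(i < size f) coef f j i * (t ^+ i * U t)%:C.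
Proof.
have wj : (omega : R[i]) ^+ j != 0 by rewrite expf_neq0// omega_neq0.
rewrite /segment_integrand /ray_integrand.
rewrite [_ ^- _ * _](_ : _ = t%:C); last by rewrite mulrCA mulVf// mulr1.
rewrite /= horner_coef !mulr_suml; apply: eq_bigr => i _.
by rewrite exprMn /coef mulnS exprD exprM rmorphM rmorphXn /=; ring.
Qed.

Let Re_sum (n : nat) (z : 'I_n -> R[i]) :
  complex.Re (\sum_(i < n) z i) = \sum_(i < n) complex.Re (z i).
Proof. by apply: (big_morph (@complex.Re R)) => // -[? ?] [? ?]. Qed.

Let Im_sum (n : nat) (z : 'I_n -> R[i]) :
  complex.Im (\sum_(i < n) z i) = \sum_(i < n) complex.Im (z i).
Proof. by apply: (big_morph (@complex.Im R)) => // -[? ?] [? ?]. Qed.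

Let Re_integrand f j t :
  complex.Re (segment_integrand (omega ^+ j) (ray_integrand U f j) t) =
  \sum_(i < size f) complex.Re (coef f j i) * (t ^+ i * U t).
Proof.
rewrite integrandE Re_sum; apply: eq_bigr => i _.
by case: (coef f j i) => x y /=; rewrite mulr0 subr0.
Qed.

Let Im_integrand f j t :
  complex.Im (segment_integrand (omega ^+ j) (ray_integrand U f j) t) =
  \sum_(i < size f) complex.Im (coef f j i) * (t ^+ i * U t).
Proof.
rewrite integrandE Im_sum; apply: eq_bigr => i _.
by case: (coef f j i) => x y /=; rewrite mulr0 add0r.
Qed.

Lemma ray_integrable_moment f : ray_integrable U f.
Proof.
move=> j _; split.
- apply: eq_integrable (integrable_linear (size f)
    (fun i => complex.Re (coef f j i)) _ iU) => //.
  by move=> t _ /=; rewrite -Re_integrand.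
- apply: eq_integrable (integrable_linear (size f)
    (fun i => complex.Im (coef f j i)) _ iU) => //.
  by move=> t _ /=; rewrite -Im_integrand.
Qed.

Let segment_integralE f j :
  segment_integral (omega ^+ j) (ray_integrand U f j) =
  \sum_(i < size f) coef f j i * (moment i)%:C.
Proof.
rewrite /segment_integral.
have -> : \int[mu]_(t in `]0, 1[) complex.Re (segment_integrand (omega ^+ j)
    (ray_integrand U f j) t) = \sum_(i < size f) complex.Re (coef f j i) *
      moment i.
  rewrite -(Rintegral_linear (size f) (fun i => complex.Re (coef f j i)) _
    iU)//.
  by apply: eq_Rintegral => t _; exact: Re_integrand.
have -> : \int[mu]_(t in `]0, 1[) complex.Im (segment_integrand (omega ^+ j)
    (ray_integrand U f j) t) = \sum_(i < size f) complex.Im (coef f j i) *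
      moment i.
  rewrite -(Rintegral_linear (size f) (fun i => complex.Im (coef f j i)) _
    iU)//.
  by apply: eq_Rintegral => t _; exact: Im_integrand.
apply/eqP; rewrite eq_complex Re_sum Im_sum /=.
apply/andP; split; apply/eqP; apply: eq_bigr => i _.
  by case: (coef f j i) => x y /=; rewrite mulr0 subr0.
by case: (coef f j i) => x y /=; rewrite mulr0 add0r.
Qed.

Definition residue_moment (k i : nat) : R[i] :=
  if (i %% 3 == k)%N then (moment i)%:C else 0.

Lemma ray_functionalE (k : nat) f : (k < 2)%N ->
  ray_functional k U f = \sum_(i < size f) f`_i * residue_moment k i.
Proof.
move=> k2; have S0 := segment_integralE f 0; have S1 := segment_integralE f 1.
rewrite expr0 in S0; rewrite expr1 in S1.
rewrite /ray_functional S0 S1 segment_integralE !mulr_sumr -!big_split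
  mulr_sumr /=.
apply: eq_bigr => i _.
(* With w = omega^(i + 2k), the three rays contribute 1, w and w^2: the third exponent, 2i + 3 - 2k,
   differs from 2i + 4k by a multiple of 3. The sum is nonzero exactly when i = k mod 3. *)
transitivity (f`_i * (moment i)%:C *
  (3^-1 * (1 + omega ^+ (i + 2 * k) + (omega ^+ (i + 2 * k)) ^+ 2))).
  rewrite [omega ^ (2 * _ - 1) * _]mulrA [omega ^ (1 - _) * _]mulrA.
  have -> : omega ^ (2 * k%:Z - 1) * coef f 1 i = f`_i * omega ^+ (i + 2 * k).
    rewrite /coef mul1n mulrCA; congr (_ * _).
    (* Multiplying by omega clears the exponent -1 that occurs for k = 0. *)
    apply: (mulfI omega_neq0).
    case: k k2 => [|[|//]] _; rewrite ?muln0 ?muln1.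
      by rewrite mulr0 sub0r mulrA exprN1 divff ?omega_neq0// mul1r addn0 exprS.
    by rewrite mulr1 -exprS addn2 -!exprS.
  have -> : omega ^ (1 - 2 * k%:Z) * coef f 2 i =
      f`_i * (omega ^+ (i + 2 * k)) ^+ 2.
    rewrite /coef mulrCA; congr (_ * _).
    apply: (mulfI omega_neq0); rewrite -exprM.
    case: k k2 => [|[|//]] _; rewrite ?muln0 ?muln1.
      rewrite mulr0 subr0 expr1z addn0 -!exprS.
      have -> : (2 * i.+1).+2 = (i * 2 + 1 + 3)%N by lia.
      by rewrite exprD omega3 mulr1 addn1.
    rewrite mulr1 mulrA (_ : 1 - 2 = -1 :> int)// exprN1 divff ?omega_neq0//
      mul1r.
    have -> : ((i + 2) * 2 = 2 * i + 1 + 3)%N by lia.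
    rewrite exprD omega3 mulr1 -exprS; congr (_ ^+ _); lia.
  rewrite /coef mul0n expr0 mulr1; ring.
rewrite omega_sum /residue_moment.
have -> : (3 %| i + 2 * k)%N = (i %% 3 == k)%N by apply/idP/eqP; lia.
by case: eqP => _; rewrite ?mulr0// mulVf ?mulr1// pnatr_eq0.
Qed.

Lemma ray_functional_scalar (k : nat) : (k < 2)%N ->
  scalar (ray_functional k U).
Proof.
move=> k2.
(* Padding with zero coefficients gives polynomials of different sizes a common summation range. *)
have E (f : {poly R[i]}) n : (size f <= n)%N ->
    ray_functional k U f = \sum_(i < n) f`_i * residue_moment k i.
  move=> fn; rewrite ray_functionalE// (big_ord_widen n (fun i => f`_i *
    residue_moment k i) fn).
  rewrite big_mkcond; apply: eq_bigr => i _; case: ltnP => // fi.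
  by rewrite nth_default// mul0r.
move=> a f g; pose n := maxn (size (a *: f + g)) (maxn (size f) (size g)).
rewrite !(E _ n) /n ?leq_max ?leqnn ?orbT//.
rewrite mulr_sumr -big_split; apply: eq_bigr => i _ /=.
by rewrite coefD coefZ; ring.
Qed.

Lemma ray_functionalXn (k n : nat) : (k < 2)%N ->
  ray_functional k U 'X^n = residue_moment k n.
Proof.
move=> k2; rewrite ray_functionalE// size_polyXn big_ord_recr /= big1 ?add0r.
  by rewrite coefXn eqxx mul1r.
by move=> i _; rewrite coefXn ltn_eqF ?mul0r.
Qed.

End ray_moments.

(** * The two weights of the statement and their moments *)

Section weights.
Context {R : realType}.
Notation mu_ := lebesgue_measure.
Variables mu rho : R.
Hypotheses (hmu : -1 < mu) (hrho : 0 < rho).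

Let c := (mu + rho + 2) / 3.
Let b := (rho + 1) / 3.

Let K0 : R := 3 * Gamma ((mu + 2) / 3) * Gamma (rho / 3 + 1) /
    (Gamma (1 / 3) * Gamma (2 / 3) * Gamma c).

Let K1 : R := 3 * Gamma ((mu + 5) / 3) * Gamma (rho / 3 + 1) /
    (Gamma (2 / 3) * Gamma (4 / 3) * Gamma c).

Let K0_gt0 : 0 < K0.
Proof.
have m := hmu; have r := hrho.
by rewrite divr_gt0//; do ?apply: mulr_gt0; rewrite ?Gamma_gt0//; rewrite /c;
  lra.
Qed.

Let K1_gt0 : 0 < K1.
Proof.
have m := hmu; have r := hrho.
by rewrite divr_gt0//; do ?apply: mulr_gt0; rewrite ?Gamma_gt0//; rewrite /c;
  lra.
Qed.

Let cE : (mu + rho - 1) / 3 = c - 1. Proof. by rewrite /c; field. Qed.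

Let calU0E i t : t ^+ i * calU0 mu rho t = K0 * hyp_weight (mu / 3) b c i t.
Proof. by rewrite /calU0 /hyp_weight cE -/c -/b -/K0; ring. Qed.

Let calU1E i t :
  t ^+ i * calU1 mu rho t = K1 * hyp_weight (mu / 3 + 1) b c (i + 2) t.
Proof. by rewrite /calU1 /hyp_weight cE -/c -/b -/K1 exprD; ring. Qed.

Let c_gt0 : 0 < c. Proof. by rewrite /c; have := hmu; have := hrho; lra. Qed.
Let b_gt0 : 0 < b. Proof. by rewrite /b; have := hrho; lra. Qed.
Let a0 : -1 < mu / 3. Proof. by have := hmu; lra. Qed.
Let a1 : -1 < mu / 3 + 1. Proof. by have := hmu; lra. Qed.

Let i_ge0 (i : nat) : 0 <= i%:R :> R. Proof. by []. Qed.

(** Since c - mu/3 - b = 1/3, this quantity is (i + 2)/3. *)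
Let d0 i : 0 < i.+1%:R / 3 + c - mu / 3 - b.
Proof. by have := i_ge0 i; rewrite -natr1 /c /b; lra. Qed.

(** This quantity is (i + 1)/3; the shift by 2 comes from the factor x^2 of [calU1]. *)
Let d1 i : 0 < (i + 2).+1%:R / 3 + c - (mu / 3 + 1) - b.
Proof. by have := i_ge0 i; rewrite -natr1 natrD /c /b; lra. Qed.

Lemma integrable_calU0 i : mu_.-integrable `]0, 1[
  (EFin \o (fun t : R => t ^+ i * calU0 mu rho t)).
Proof.
rewrite (_ : (fun t => _) = fun t => K0 * hyp_weight (mu / 3) b c i t).
  exact: (integrableZl _ _ (integrable_hyp_weight a0 b_gt0 c_gt0 (d0 i))).
by apply/funext => t; exact: calU0E.
Qed.

Lemma integrable_calU1 i : mu_.-integrable `]0, 1[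
  (EFin \o (fun t : R => t ^+ i * calU1 mu rho t)).
Proof.
rewrite (_ : (fun t => _) = fun t =>
    K1 * hyp_weight (mu / 3 + 1) b c (i + 2) t).
  exact: (integrableZl _ _ (integrable_hyp_weight a1 b_gt0 c_gt0 (d1 i))).
by apply/funext => t; exact: calU1E.
Qed.

Lemma moment_calU0 i :
  moment (calU0 mu rho) i = K0 * hyp_moment (mu / 3) b c i.
Proof.
rewrite /hyp_moment -RintegralZl//; last exact: integrable_hyp_weight.
by apply: eq_Rintegral => t _; exact: calU0E.
Qed.

Lemma moment_calU1 i :
  moment (calU1 mu rho) i = K1 * hyp_moment (mu / 3 + 1) b c (i + 2).
Proof.
rewrite /hyp_moment -RintegralZl//; last exact: integrable_hyp_weight.
by apply: eq_Rintegral => t _; exact: calU1E.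
Qed.

(** With s = j + 1/3, C - a and C - b are [connB mu rho 0] + j and [connA mu rho 0] + j up to the
    choice of parameters, and s (C - a - b) = (j + 1/3)(j + 2/3): this is the ratio in [connS]. *)
Lemma moment_calU0_conn j :
  moment (calU0 mu rho) (3 * j) = conn mu rho 0 j * moment (calU0 mu rho) 0.
Proof.
have m := hmu; have r := hrho.
elim: j => [|j IH]; first by rewrite connk0 mul1r.
rewrite (connS hmu hrho) mulrAC -IH !moment_calU0.
have -> : (3 * j.+1 = 3 * j + 3)%N by lia.
have H := hyp_momentD3 a0 b_gt0 c_gt0 (d0 (3 * j)).
have j0 := i_ge0 j.
have E : (3 * j).+1%:R / 3 = j%:R + 1 / 3 :> R.
  by rewrite -(natr1 (3 * j)) natrM; field.
rewrite E in H.
have nz : (j%:R + 1 / 3 + c - mu / 3) * (j%:R + 1 / 3 + c - b) != 0.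
  by rewrite gt_eqF// mulr_gt0// /c /b; lra.
apply: (mulfI nz); rewrite mulrCA H.
rewrite /connA /connB /= /c /b.
field; do ?(apply/andP; split); apply/eqP; lra.
Qed.

(** Here s = j + 4/3 and C - a - b = j + 2/3, while C - a = rho/3 + 1 + j and C - b = (mu + 5)/3 +
    j, which is the ratio in [connS] for k = 1. *)
Lemma moment_calU1_conn j :
  moment (calU1 mu rho) (1 + 3 * j) = conn mu rho 1 j * moment (calU1 mu rho) 1.
Proof.
have m := hmu; have r := hrho.
elim: j => [|j IH]; first by rewrite connk0 mul1r muln0.
rewrite (connS hmu hrho) mulrAC -IH !moment_calU1.
have -> : (1 + 3 * j.+1 + 2 = 1 + 3 * j + 2 + 3)%N by lia.
have H := hyp_momentD3 a1 b_gt0 c_gt0 (d1 (1 + 3 * j)).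
have j0 := i_ge0 j.
have E : (1 + 3 * j + 2).+1%:R / 3 = j%:R + 4 / 3 :> R.
  by rewrite -(natr1 (1 + 3 * j + 2)) 2!natrD natrM; field.
rewrite E in H.
have nz : (j%:R + 4 / 3 + c - (mu / 3 + 1)) * (j%:R + 4 / 3 + c - b) != 0.
  by rewrite gt_eqF// mulr_gt0// /c /b; lra.
apply: (mulfI nz); rewrite mulrCA H.
rewrite /connA /connB /= /c /b.
field; do ?(apply/andP; split); apply/eqP; lra.
Qed.

Lemma moment_calU0_gt0 : 0 < moment (calU0 mu rho) 0.
Proof.
have m := hmu; have r := hrho.
rewrite moment_calU0; apply: (mulr_gt0 K0_gt0).
apply: (hyp_moment_gt0 a0 b_gt0 c_gt0); last exact: (d0 0).
by rewrite /b /c; lra.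
Qed.

Lemma moment_calU1_gt0 : 0 < moment (calU1 mu rho) 1.
Proof.
have m := hmu; have r := hrho.
rewrite moment_calU1; apply: (mulr_gt0 K1_gt0).
apply: (hyp_moment_gt0 a1 b_gt0 c_gt0); last exact: (d1 1).
by rewrite /b /c; lra.
Qed.

End weights.

Theorem proposition3p13 (R : realType) (mu rho : R) (hmu : -1 < mu)
    (hrho : 0 < rho) (P : nat -> {poly R[i]})
    (P0 : P 0%N = 1) (P1 : P 1%N = 'X) (P2 : P 2%N = 'X^2)
    (Prec : forall n : nat, (2 <= n)%N ->
       P n.+1 = 'X * P n - (gamma_coef mu rho n.-1)%:C *: P n.-2) :
  [/\ threefold_symmetric P,
      forall f : {poly R[i]},
        ray_integrable (calU0 mu rho) f /\ ray_integrable (calU1 mu rho) f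
    & two_orthogonal (ray_functional 0 (calU0 mu rho))
        (ray_functional 1 (calU1 mu rho)) P].
Proof.
have i0 := integrable_calU0 hmu hrho; have i1 := integrable_calU1 hmu hrho.
have s0 := ray_functional_scalar i0 (isT : 0 < 2)%N.
have s1 := ray_functional_scalar i1 (isT : 1 < 2)%N.
split.
- by move=> n x; apply: (threefold_symmetric_P hmu hrho P0 P1 P2 Prec omega3).
- by move=> f; split; apply: ray_integrable_moment.
(* The filter kills the monomials outside the residue class, and the moment ratios give the values
   inside it. *)
have u0 n : (n != 0)%N -> ray_functional 0 (calU0 mu rho) (P n) = 0.
  apply: (dual_functional hmu hrho P0 P1 P2 Prec s0) => //.
  - by move=> k k0; rewrite ray_functionalXn// /residue_moment ifN.
  - move=> j; rewrite !ray_functionalXn// /residue_moment add0n modnMr mod0n /=.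
    by rewrite (moment_calU0_conn hmu hrho) rmorphM.
have u1 n : (n != 1)%N -> ray_functional 1 (calU1 mu rho) (P n) = 0.
  apply: (dual_functional hmu hrho P0 P1 P2 Prec s1) => //.
  - by move=> k k0; rewrite ray_functionalXn// /residue_moment ifN.
  - move=> j; rewrite !ray_functionalXn// /residue_moment.
    have -> : ((1 + 3 * j) %% 3 == 1)%N by apply/eqP; lia.
    by rewrite (moment_calU1_conn hmu hrho) rmorphM.
have u00 : ray_functional 0 (calU0 mu rho) (P 0%N) != 0.
  rewrite P0 -(expr0 'X) (ray_functionalXn i0 0 (isT : 0 < 2)%N).
  have -> : residue_moment (calU0 mu rho) 0 0 = (moment (calU0 mu rho) 0)%:C.
    by rewrite /residue_moment mod0n eqxx.
  by rewrite fmorph_eq0 (gt_eqF (moment_calU0_gt0 hmu hrho)).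
have u11 : ray_functional 1 (calU1 mu rho) (P 1%N) != 0.
  rewrite P1 -(expr1 'X) (ray_functionalXn i1 1 (isT : 1 < 2)%N).
  have -> : residue_moment (calU1 mu rho) 1 1 = (moment (calU1 mu rho) 1)%:C.
    by rewrite /residue_moment modn_small ?eqxx.
  by rewrite fmorph_eq0 (gt_eqF (moment_calU1_gt0 hmu hrho)).
have [orth0 orth1] := two_orthogonal_of_dual hmu hrho Prec s0 s1 u0 u00 u1 u11.
split; [|exact: (conj s0 s1)|exact: orth0|exact: orth1].
exact: (monic_sequence_P hmu hrho P0 P1 P2 Prec).
Qed.
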